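(* Let $n\ge 2$, let $d_1,\ldots,d_n\ge 2$ all be even, and put $G=C(d_1,\ldots,d_n)$ and $N=|V(G)|$, with $N\ge 8$. Then $G$ is 2-DCC edge $[4,N/2]$-bipancyclic if and only if $G\not\cong K_2\mathbin{\square} C_{2p}$ for every integer $p\ge 3$. The remaining order-four graph $C(2,2)\cong C_4$ has no 2-DCC.
   Context: All graphs are finite, undirected and simple. $C_m$ denotes the cycle on $m$ vertices and $K_2$ the complete graph on two vertices. The Cartesian product $A\mathbin{\square}B$ has vertex set $V(A)\times V(B)$, with $(a,b)$ and $(a',b')$ adjacent iff either $a=a'$ and $bb'\in E(B)$, or $b=b'$ and $aa'\in E(A)$. Generalized hypercube: for $d_1,\ldots,d_n\ge 2$, $C(d_1,\ldots,d_n)=F_1\mathbin{\square}\cdots\mathbin{\square}F_n$, where $F_i=K_2$ if $d_i=2$ and $F_i=C_{d_i}$ if $d_i\ge 3$. (It is bipartite exactly when all $d_i$ are even.) The length $|J|$ of a cycle $J$ is its number of edges. Two edges are independent if they have no common end. A two-disjoint-cycle cover (2-DCC) of a graph $H$ is a pair $(J_1,J_2)$ of cycles (subgraphs of $H$) with $V(J_1)\cap V(J_2)=\varnothing$ and $V(J_1)\cup V(J_2)=V(H)$. Let $H$ be a bipartite graph of order $m$ and let $4\le r_1\le r_2\le m/2$. $H$ is 2-DCC edge $[r_1,r_2]$-bipancyclic if for every ordered pair of independent edges $(e,f)$ of $H$ and every even integer $\ell$ with $r_1\le \ell\le r_2$, there is a 2-DCC $(J_1,J_2)$ of $H$ such that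 $|J_1|=\ell$, $|J_2|=m-\ell$, $e\in E(J_1)$ and $f\in E(J_2)$. *)

(* Defs.v *)
From mathcomp Require Import all_boot.

Set Implicit Arguments.
Unset Strict Implicit.
Unset Printing Implicit Defensive.

Record sgraph := SGraph {
  svertex :> finType;
  adj : rel svertex;
  adj_sym : symmetric adj;
  adj_irr : irreflexive adj
}.

Arguments adj {s}.

Definition edges (G : sgraph) : {set {set G}} :=
  [set [set p.1; p.2] | p : G * G & adj p.1 p.2].

Definition independent (G : sgraph) (e f : {set G}) : bool := [disjoint e & f].

Definition bipartite (G : sgraph) : Prop :=
  exists side : G -> bool, forall x y : G, adj x y -> side x != side y.

Definition isomorphic (G H : sgraph) : Prop :=
  exists2 f : G -> H, bijective f & forall x y : G, adj (f x) (f y) = adj x y.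

Section Complete.
Variable m : nat.

Definition complete_adj : rel 'I_m := fun i j => i != j.

Lemma complete_adj_sym : symmetric complete_adj.
Proof. by move=> i j; rewrite /complete_adj eq_sym. Qed.

Lemma complete_adj_irr : irreflexive complete_adj.
Proof. by move=> i; rewrite /complete_adj eqxx. Qed.

Definition complete_graph : sgraph := SGraph complete_adj_sym complete_adj_irr.
End Complete.

(* This is the cycle C_m only for m >= 3; the conjunct i != j merely excludes
   the loop that would arise for m = 1. *)
Section CycleGraph.
Variable m : nat.

Definition cycle_adj : rel 'I_m :=
  fun i j => (i != j) && ((i.+1 %% m == j) || (j.+1 %% m == i)).

Lemma cycle_adj_sym : symmetric cycle_adj.
Proof. by move=> i j; rewrite /cycle_adj eq_sym orbC. Qed.

Lemma cycle_adj_irr : irreflexive cycle_adj.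
Proof. by move=> i; rewrite /cycle_adj eqxx. Qed.

Definition cycle_graph : sgraph := SGraph cycle_adj_sym cycle_adj_irr.
End CycleGraph.

Section CartesianProduct.
Variables A B : sgraph.

Definition cart_adj : rel (A * B)%type := fun x y =>
  (x.1 == y.1) && adj x.2 y.2 || (x.2 == y.2) && adj x.1 y.1.

Lemma cart_adj_sym : symmetric cart_adj.
Proof.
by move=> x y; rewrite /cart_adj (eq_sym x.1) (eq_sym x.2) (adj_sym x.1) (adj_sym x.2).
Qed.

Lemma cart_adj_irr : irreflexive cart_adj.
Proof. by move=> x; rewrite /cart_adj !adj_irr !andbF. Qed.

Definition cart_prod : sgraph := SGraph cart_adj_sym cart_adj_irr.
End CartesianProduct.

Definition hypercube_factor (d : nat) : sgraph :=
  if d == 2 then complete_graph 2 else cycle_graph d.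

(* The iterated product is bracketed to the right; the empty product is K_1. *)
Fixpoint gen_hypercube (ds : seq nat) : sgraph :=
  match ds with
  | [::] => complete_graph 1
  | [:: d] => hypercube_factor d
  | d :: ds' => cart_prod (hypercube_factor d) (gen_hypercube ds')
  end.

(* A cycle subgraph is given by the cyclic sequence of its vertices: the
   sequence is closed up by the edge from its last to its first element. *)
Definition is_cycle (G : sgraph) (J : seq G) : bool :=
  [&& 2 < size J, uniq J & cycle adj J].

Definition cycle_vertices (G : sgraph) (J : seq G) : {set G} :=
  [set x in J].

Definition cycle_edges (G : sgraph) (J : seq G) : {set {set G}} :=
  [set [set x; next J x] | x in J].

Definition cycle_length (G : sgraph) (J : seq G) : nat := #|cycle_edges J|.

Definition two_dcc (G : sgraph) (J1 J2 : seq G) : Prop :=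
  [/\ is_cycle J1, is_cycle J2,
      cycle_vertices J1 :&: cycle_vertices J2 = set0
    & cycle_vertices J1 :|: cycle_vertices J2 = [set: G]].

Definition two_dcc_edge_bipancyclic (G : sgraph) (r1 r2 : nat) : Prop :=
  [/\ bipartite G, 4 <= r1 <= r2, r2.*2 <= #|G|
    & forall e f : {set G}, e \in edges G -> f \in edges G ->
      independent e f ->
      forall l : nat, ~~ odd l -> r1 <= l <= r2 ->
      exists J1 J2 : seq G,
        [/\ two_dcc J1 J2,
            cycle_length J1 = l, cycle_length J2 = #|G| - l,
            e \in cycle_edges J1 & f \in cycle_edges J2]].

(* Main.v *)
Require Import Defs.
From mathcomp Require Import all_boot zify.

(** Why the theorem holds.

    The prisms fail for l = 4.  In the product of K_2 with C_2p, p >= 3, a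
    4-cycle through an edge e of one of the long cycles has to be the square
    over e.  Deleting that square leaves a ladder with at least four rungs, and
    the only Hamiltonian cycle of a ladder is its boundary; so no admissible
    second cycle contains an inner rung ([prism_no_dcc]).

    All other cases are reduced to a torus.  Any two edges of a generalized
    hypercube with even dimensions lie on a common Hamiltonian cycle (a single
    edge, for K_2): by induction on the number of factors, since two
    Hamiltonian cycles of the factors span a torus in the product, and in an
    even torus two edges lie on a common Hamiltonian cycle ([ham_torus],
    [gen_hypercube_hamiltonian]).  Hence, if G is a product of A and B, the
    projections of e and f to A lie on a Hamiltonian cycle of A and those to B
    on one of B, so that e and f both lie on a spanning torus with |A| rows and
    |B| columns ([product_torus]).  Regrouping the factors, |A| >= 4 and
    |B| >= 4 can be achieved except for the prisms and for the cube on eight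
    vertices ([gen_hypercube_factorization]); in the cube only l = 4 occurs,
    and two opposite faces do ([splits_cube]).

    On a torus with 2m rows and b columns, both even and at least four, the
    rows are grouped in pairs.  A row pair is a prism over C_b, and consecutive
    row pairs can be merged by exchanging two parallel horizontal edges for the
    two vertical edges between them; thus a block of row pairs has a
    Hamiltonian cycle through any prescribed edge ([tours_stack]).  Writing
    l = 2 (q b + r) with r < b, the first cycle covers q row pairs and r columns
    of the next one; such a region is called a comb, with a deviation for
    r = 1 and r = b - 1, where a single column could not be attached.  The
    complement of a comb is again a comb after a half turn, so that one lemma
    ([tours_comb]) yields both cycles.  Swapping the axes, translating and
    reflecting, e comes to lie in the first row pair and f outside it
    ([splits_torus]), and b >= 4 leaves enough room to choose the columns of the
    attachments without destroying e or f ([splits_tall]).  If q = 0, the first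
    cycle lies inside one row pair and is a ladder or a zigzag
    ([splits_short]). *)

Set Implicit Arguments.
Unset Strict Implicit.
Unset Printing Implicit Defensive.

(** * Cycles as vertex sequences *)

Lemma set2_inj (T : finType) (x y u v : T) :
  [set x; y] = [set u; v] -> (x = u /\ y = v) \/ (x = v /\ y = u).
Proof.
move=> E.
have /set2P[] : x \in [set u; v] by rewrite -E set21.
  move=> xu; left; split=> //.
  have /set2P[yu|//] : y \in [set u; v] by rewrite -E set22.
  have /set2P[vx|vy] : v \in [set x; y] by rewrite E set22.
    by rewrite yu vx xu.
  by rewrite vy.
move=> xv; right; split=> //.
have /set2P[//|yv] : y \in [set u; v] by rewrite -E set22.
have /set2P[ux|uy] : u \in [set x; y] by rewrite E set21.
  by rewrite yv ux xv.
by rewrite uy.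
Qed.

Lemma fresh_below (s : seq nat) n : size s < n -> exists2 t, t < n & t \notin s.
Proof.
move=> lt_s; have /allPn[t] : ~~ all [in s] (iota 0 n).
  apply/negP=> /allP /(uniq_leq_size (iota_uniq 0 n)).
  by rewrite size_iota leqNgt lt_s.
by rewrite mem_iota => lt_t nt; exists t.
Qed.

Section Circuits.
Variable G : sgraph.
Implicit Types (J s : seq G) (e : {set G}) (x y z t : G).

(** A cycle, or else a single edge traversed back and forth: this degenerate
    case lets an edge be absorbed and makes K_2 behave like a cycle. *)
Definition circuit J := [&& 1 < size J, uniq J & cycle adj J].

Lemma circuit_uniq J : circuit J -> uniq J. Proof. by case/and3P. Qed.

Lemma circuit_is_cycle J : circuit J -> 2 < size J -> is_cycle J.
Proof. by case/and3P=> _ u c s; apply/and3P. Qed.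

Lemma cycle_edgesP J e :
  reflect (exists2 x, x \in J & e = [set x; next J x]) (e \in cycle_edges J).
Proof. exact: imsetP. Qed.

Lemma cycle_edges_rot n J : uniq J -> cycle_edges (rot n J) = cycle_edges J.
Proof.
move=> uJ; apply/setP=> e; apply/cycle_edgesP/cycle_edgesP=> -[x xJ ->];
  by exists x; rewrite ?mem_rot ?next_rot // -(mem_rot n).
Qed.

Lemma cycle_edges_rev J : uniq J -> cycle_edges (rev J) = cycle_edges J.
Proof.
move=> uJ; apply/setP=> e; apply/cycle_edgesP/cycle_edgesP=> -[x xJ ->].
  exists (prev J x); first by rewrite mem_prev -mem_rev.
  by rewrite next_rev // next_prev // setUC.
exists (next J x); first by rewrite mem_rev mem_next.
by rewrite next_rev // prev_next // setUC.
Qed.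

Lemma circuit_rot n J : circuit (rot n J) = circuit J.
Proof. by rewrite /circuit size_rot rot_uniq rot_cycle. Qed.

Lemma circuit_rev J : circuit (rev J) = circuit J.
Proof.
rewrite /circuit size_rev rev_uniq -[in RHS]rev_cycle.
by do 2!congr (_ && _); apply: eq_cycle => x y; rewrite adj_sym.
Qed.

Lemma edge_consec J s1 s2 x y :
  uniq J -> J = s1 ++ [:: x, y & s2] -> [set x; y] \in cycle_edges J.
Proof.
move=> uJ EJ; rewrite -(cycle_edges_rot (size s1) uJ).
have uR : uniq (rot (size s1) J) by rewrite rot_uniq.
move: uR; rewrite EJ rot_size_cat /= => _.
by apply/cycle_edgesP; exists x; rewrite ?inE ?eqxx //= eqxx.
Qed.

Lemma edge_wrap s x y :
  uniq (x :: rcons s y) -> [set x; y] \in cycle_edges (x :: rcons s y).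
Proof.
move=> uJ; rewrite -(cycle_edges_rot (size (x :: s)) uJ) -rcons_cons -cats1.
rewrite rot_size_cat setUC; apply: (@edge_consec _ [::] s) => //=.
by move: uJ; rewrite /= mem_rcons rcons_uniq !inE negb_or andbA (eq_sym y) negb_or
  -!andbA => /and4P[-> -> -> ->].
Qed.

Lemma edge_inv J e : 1 < size J -> uniq J -> e \in cycle_edges J ->
  exists x y s1 s2, e = [set x; y] /\
    (J = s1 ++ [:: x, y & s2] \/ J = x :: rcons s1 y).
Proof.
move=> sJ uJ /cycle_edgesP[x xJ ->].
case/splitPr: xJ sJ uJ => p1 [|z p2] sJ uJ.
  case: p1 sJ uJ => [//|h p1] _ uJ; exists h, x, p1, [::].
  split; last by right; rewrite cats1.
  rewrite setUC; congr [set _; _].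
  rewrite -(next_rot (size (h :: p1)) uJ) rot_size_cat /= eqxx //.
exists x, z, p1, p2; split; last by left.
by rewrite -(next_rot (size p1) uJ) rot_size_cat /= eqxx.
Qed.

(** Rotating, and reversing if need be, makes any edge the closing edge; the
    surgeries below cut circuits open there. *)
Lemma open_circuit J x y : circuit J -> [set x; y] \in cycle_edges J ->
  exists s, [/\ circuit (x :: rcons s y), perm_eq (x :: rcons s y) J
              & cycle_edges (x :: rcons s y) = cycle_edges J].
Proof.
move=> cJ; have uJ := circuit_uniq cJ; have sJ : 1 < size J by case/and3P: cJ.
have key K u v : circuit K -> u \in K -> v = next K u ->
    exists s, [/\ circuit (v :: rcons s u), perm_eq (v :: rcons s u) K
              & cycle_edges (v :: rcons s u) = cycle_edges K].
  move=> cK /rot_to[i [|w s] EK] nu.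
    by case/and3P: cK; rewrite -(size_rot i) EK.
  have uK := circuit_uniq cK.
  have vw : v = w by rewrite nu -(next_rot i uK) EK /= eqxx.
  have E1 : v :: rcons s u = rot 1 (rot i K) by rewrite EK vw /= rot1_cons.
  exists s; rewrite E1; split; first by rewrite !circuit_rot.
    by rewrite perm_rot perm_rot.
  by rewrite !cycle_edges_rot // rot_uniq.
case/cycle_edgesP=> u uJ' /set2_inj[] [-> ->].
  have [|||s [c p E]] := @key (rev J) (next J u) u.
  - by rewrite circuit_rev.
  - by rewrite mem_rev mem_next.
  - by rewrite next_rev // prev_next.
  by exists s; split; rewrite ?E ?cycle_edges_rev // (perm_trans p) // perm_rev.
exact: key.
Qed.

Lemma circuit_cat x s y z s' t :
  circuit (x :: rcons s y) -> path adj z (rcons s' t) -> uniq (z :: rcons s' t) ->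
  {in x :: rcons s y, forall v, v \notin z :: rcons s' t} ->
  adj y z -> adj t x -> circuit ((x :: rcons s y) ++ (z :: rcons s' t)).
Proof.
move=> /and3P[_ u1 c1] p2 u2 dis a1 a2; apply/and3P; split.
- by rewrite size_cat /= size_rcons.
- rewrite cat_uniq u1 u2 andbT; apply/hasPn=> v vz.
  by apply: contraL vz => /dis.
move: c1; rewrite /= rcons_cat cat_path /= -cats1 cat_path => /andP[p1 _].
move: p1; rewrite -cats1 => p1; rewrite last_cat /= a1 /=.
by rewrite p1 /= rcons_path p2 last_rcons.
Qed.

(** Two disjoint circuits with parallel edges [xy] and [x'y'] become one when
    these edges are exchanged for [xx'] and [yy']. *)
Lemma merge_circuits J1 J2 x y x' y' :
  circuit J1 -> circuit J2 -> {in J1, forall v, v \notin J2} ->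
  [set x; y] \in cycle_edges J1 -> [set x'; y'] \in cycle_edges J2 ->
  adj x x' -> adj y y' ->
  exists J, [/\ circuit J, perm_eq J (J1 ++ J2),
    forall e, e \in cycle_edges J1 -> e != [set x; y] -> e \in cycle_edges J,
    forall e, e \in cycle_edges J2 -> e != [set x'; y'] -> e \in cycle_edges J
    & ([set x; x'] \in cycle_edges J) && ([set y; y'] \in cycle_edges J)].
Proof.
move=> c1 c2 dis e1 e2 ax ay.
have [s [cs ps Es]] := open_circuit c1 e1.
move: e2; rewrite setUC => e2; have [s' [ct pt Et]] := open_circuit c2 e2.
have cJ : circuit ((x :: rcons s y) ++ (y' :: rcons s' x')).
  apply: circuit_cat => //; last by rewrite adj_sym.
  - by case/and3P: ct => _ _; rewrite /= rcons_path => /andP[].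
  - exact: circuit_uniq ct.
  by move=> v; rewrite (perm_mem ps) (perm_mem pt); apply: dis.
have uJ := circuit_uniq cJ; exists ((x :: rcons s y) ++ (y' :: rcons s' x')); split=> //.
- by rewrite perm_cat.
- move=> e; rewrite -Es => /edge_inv[||u [v [t1 [t2 [-> [E|[]]]]]]] //.
  + by case/and3P: cs.
  + exact: circuit_uniq.
  + by move=> _; apply: (@edge_consec _ t1 (t2 ++ y' :: rcons s' x')); rewrite // E -catA.
  by move=> -> /rcons_inj[_ ->]; rewrite eqxx.
- move=> e; rewrite -Et => /edge_inv[||u [v [t1 [t2 [-> [E|[]]]]]]] //.
  + by case/and3P: ct.
  + exact: circuit_uniq.
  + by move=> _; apply: (@edge_consec _ ((x :: rcons s y) ++ t1) t2); rewrite // E catA.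
  by move=> -> /rcons_inj[_ ->]; rewrite setUC eqxx.
apply/andP; split.
  move: uJ; rewrite cat_cons -rcons_cons -rcons_cat => uJ; exact: edge_wrap.
apply: (@edge_consec _ (x :: s) (rcons s' x')) => //.
by rewrite -rcons_cons cat_rcons.
Qed.

(** Replacing the edge [xy] by the path [x, x', y', y] enlarges a circuit by two
    vertices.  This is a merge with the degenerate circuit on [x'y'], except
    that [x'y'] survives. *)
Lemma absorb_edge J x y x' y' :
  circuit J -> [set x; y] \in cycle_edges J ->
  x' \notin J -> y' \notin J -> adj x' y' -> adj x x' -> adj y y' ->
  exists J', [/\ circuit J', perm_eq J' (J ++ [:: x'; y']),
    forall e, e \in cycle_edges J -> e != [set x; y] -> e \in cycle_edges J'
    & [&& [set x; x'] \in cycle_edges J', [set y; y'] \in cycle_edges J'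
        & [set x'; y'] \in cycle_edges J']].
Proof.
move=> c e x'J y'J a' ax ay.
have xy' : x' != y' by apply: contraTneq a' => ->; rewrite adj_irr.
have [s [cs ps Es]] := open_circuit c e.
have cJ : circuit ((x :: rcons s y) ++ (y' :: rcons [::] x')).
  apply: circuit_cat => //; last by rewrite adj_sym.
  - by rewrite /= adj_sym a'.
  - by rewrite /= inE eq_sym xy'.
  move=> v; rewrite (perm_mem ps) => vJ.
  by rewrite /= !inE negb_or; apply/andP; split;
    [apply: contraNneq y'J | apply: contraNneq x'J] => <-.
have uJ := circuit_uniq cJ; exists ((x :: rcons s y) ++ [:: y'; x']); split=> //.
- by apply: perm_cat => //; apply: (permEl (perm_catC [:: y'] [:: x'])).
- move=> d; rewrite -Es => /edge_inv[||u [v [t1 [t2 [-> [E|[]]]]]]] //.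
  + by case/and3P: cs.
  + exact: circuit_uniq.
  + by move=> _; apply: (@edge_consec _ t1 (t2 ++ [:: y'; x'])); rewrite // E -catA.
  by move=> -> /rcons_inj[_ ->]; rewrite eqxx.
apply/and3P; split.
- move: uJ; rewrite cat_cons -[_ ++ _]/(rcons s y ++ rcons [:: y'] x') -rcons_cat => uJ.
  exact: edge_wrap.
- by apply: (@edge_consec _ (x :: s) [:: x']); rewrite // -rcons_cons cat_rcons.
by rewrite setUC; apply: (@edge_consec _ (x :: rcons s y) [::]).
Qed.

Lemma square_circuit x y z t :
  uniq [:: x; y; z; t] -> adj x y -> adj y z -> adj z t -> adj t x ->
  circuit [:: x; y; z; t] /\
  [&& [set x; y] \in cycle_edges [:: x; y; z; t],
      [set y; z] \in cycle_edges [:: x; y; z; t],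
      [set z; t] \in cycle_edges [:: x; y; z; t]
    & [set t; x] \in cycle_edges [:: x; y; z; t]].
Proof.
move=> u a1 a2 a3 a4; split; first by rewrite /circuit u /= a1 a2 a3 a4.
apply/and4P; split.
- exact: (@edge_consec _ [::] [:: z; t]).
- exact: (@edge_consec _ [:: x] [:: t]).
- exact: (@edge_consec _ [:: x; y] [::]).
by rewrite setUC; apply: (@edge_wrap [:: y; z]).
Qed.

Lemma next_next_neq J x : uniq J -> 2 < size J -> x \in J ->
  next J (next J x) != x.
Proof.
move=> uJ sJ xJ; have [i s Ei] := rot_to xJ.
rewrite -!(next_rot i uJ) Ei.
have: uniq (x :: s) by rewrite -Ei rot_uniq.
have: 2 < size (x :: s) by rewrite -Ei size_rot.
case: s {Ei} => [|y1 [|y2 s]] //= _; rewrite !eqxx !inE !negb_or.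
by case/andP=> /and3P[n1 n2 _] _ /=; case: ifP => _; rewrite eq_sym ?n1 ?n2.
Qed.

(** On three or more vertices distinct vertices start distinct edges, as the
    successor map has no orbit of size two. *)
Lemma cycle_lengthE J : is_cycle J -> cycle_length J = size J.
Proof.
case/and3P=> sJ uJ _; rewrite /cycle_length /cycle_edges card_in_imset.
  exact/card_uniqP.
move=> x y xJ yJ /set2_inj[[//]|[xy nxy]].
by have := next_next_neq uJ sJ xJ; rewrite nxy -xy eqxx.
Qed.

End Circuits.

(** * Toroidal parametrizations *)

(** A spanning torus with [a] rows and [b] columns in [G], as a doubly periodic
    map.  Adjacency in [G] is only required where the torus has an edge, so [G]
    may have further edges; for [a = 2] this is a prism.  Periodic indices make
    the symmetries of the torus mere changes of variables. *)
Record toroidal (G : sgraph) (a b : nat) (phi : nat -> nat -> G) : Prop := Toroidal {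
  tor_row : forall i j, phi (i + a) j = phi i j;
  tor_col : forall i j, phi i (j + b) = phi i j;
  tor_adjv : forall i j, adj (phi i j) (phi i.+1 j);
  tor_adjh : forall i j, adj (phi i j) (phi i j.+1);
  tor_surj : forall x, exists i j, [/\ i < a, j < b & x = phi i j];
  tor_inj : forall i j i' j', phi i j = phi i' j' ->
    i = i' %[mod a] /\ j = j' %[mod b]
}.

Definition hedge (G : sgraph) (phi : nat -> nat -> G) i j : {set G} :=
  [set phi i j; phi i j.+1].
Definition vedge (G : sgraph) (phi : nat -> nat -> G) i j : {set G} :=
  [set phi i j; phi i.+1 j].

(** Congruences are used through this form, whose side conditions are linear. *)
Lemma eq_mod_window n i i' : i = i' %[mod n] -> i < i' + n -> i' < i + n -> i = i'.
Proof.
wlog le_ii' : i i' / i <= i'.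
  move=> W E l1 l2; case: (leqP i i') => [le|/ltnW le]; first exact: W.
  by apply/esym/W.
move=> /esym/eqP; rewrite eqn_mod_dvd // => dv _ lt.
case: (posnP (i' - i)) => [|p]; first lia.
by have := dvdn_leq p dv; lia.
Qed.

Section Torus.
Variables (G : sgraph) (a b : nat) (phi : nat -> nat -> G).
Hypothesis tor : toroidal a b phi.

Lemma tor_window i j i' j' : phi i j = phi i' j' ->
  i < i' + a -> i' < i + a -> j < j' + b -> j' < j + b -> i = i' /\ j = j'.
Proof.
by move=> /(tor_inj tor)[Ei Ej] *; split; [apply: eq_mod_window Ei _ _|
  apply: eq_mod_window Ej _ _].
Qed.

Lemma tor_mod i i' j : i = i' %[mod a] -> phi i j = phi i' j.
Proof.
have red k : phi k j = phi (k %% a) j.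
  rewrite {1}(divn_eq k a) addnC; elim: (k %/ a) => [|n IH]; first by rewrite addn0.
  by rewrite mulSnr addnA (tor_row tor).
by move=> E; rewrite red E -red.
Qed.

Lemma card_torus : #|G| = a * b.
Proof.
pose f (p : 'I_a * 'I_b) := phi p.1 p.2.
have f_inj : injective f.
  move=> [i j] [i' j'] /= /tor_window E.
  have [||||Ei Ej] := E; try by apply: ltn_addl; apply: ltn_ord.
  by congr (_, _); apply: val_inj.
rewrite -{1}(card_ord a) -{1}(card_ord b) -card_prod.
rewrite -(card_codom f_inj); apply: eq_card => x.
have [i [j [lt_i lt_j ->]]] := tor_surj tor x.
by apply/esym/codomP; exists (Ordinal lt_i, Ordinal lt_j).
Qed.

Lemma hedge_col i j : hedge phi i (j + b) = hedge phi i j.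
Proof. by rewrite /hedge -addSn !(tor_col tor). Qed.
Lemma vedge_col i j : vedge phi i (j + b) = vedge phi i j.
Proof. by rewrite /vedge !(tor_col tor). Qed.

Lemma hedge_inj i j i' j' : 3 <= b -> i < i' + a -> i' < i + a ->
  j < j' + b -> j' < j + b ->
  hedge phi i j = hedge phi i' j' -> i = i' /\ j = j'.
Proof.
move=> b3 ? ? ? ?; case/set2_inj=> -[E1 E2]; first exact: tor_window E1 _ _ _ _.
have [_ F1] := tor_inj tor E1; have [_ F2] := tor_inj tor E2.
suff: j = j.+2 by lia.
apply: (@eq_mod_window b); try lia.
by rewrite F1 -[j'.+1]addn1 -modnDml -F2 modnDml addn1.
Qed.

Lemma vedge_col_inj i j j' : j < j' + b -> j' < j + b ->
  vedge phi i j = vedge phi i j' -> j = j'.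
Proof.
move=> ? ?; case/set2_inj=> -[E1 E2]; have [_ F1] := tor_inj tor E1;
exact: eq_mod_window F1 _ _.
Qed.

Lemma hedge_neq_vedge i j i' j' : 1 < a -> 1 < b -> hedge phi i j != vedge phi i' j'.
Proof.
move=> a1 b1; apply/eqP=> /set2_inj[] [E1 E2];
have [F1 _] := tor_inj tor E1; have [F2 _] := tor_inj tor E2;
have : i' = i'.+1 %[mod a] by rewrite -F1 -F2.
  by move/eq_mod_window; lia.
by move=> H; have := eq_mod_window H; lia.
Qed.

End Torus.

(** * Tours of parts of a torus *)

(** Regions are predicates on coordinates, so that unions and disjointness of
    tours become statements about indices. *)
Definition tours (G : sgraph) a b (phi : nat -> nat -> G) (P : nat -> nat -> bool)
    (n : nat) (E : {set G} -> Prop) : Prop :=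
  exists J : seq G, [/\ circuit J, size J = n,
    forall i j, i < a -> j < b -> (phi i j \in J) = P i j
    & forall e, E e -> e \in cycle_edges J].

Section Tours.
Variables (G : sgraph) (a b : nat) (phi : nat -> nat -> G).
Hypotheses (tor : toroidal a b phi) (a_gt1 : 1 < a) (b_gt2 : 2 < b).
Local Notation tours := (tours a b phi).

Lemma tours_weaken P n E P' n' (E' : {set G} -> Prop) : tours P n E ->
  (forall i j, i < a -> j < b -> P i j = P' i j) -> n = n' ->
  (forall e, E' e -> E e) -> tours P' n' E'.
Proof.
move=> [J [cJ sJ mJ eJ]] eqP <- sub; exists J; split=> //.
  by move=> i j lt_i lt_j; rewrite mJ // eqP.
by move=> e /sub /eJ.
Qed.

Lemma tours_merge P1 n1 E1 P2 n2 E2 i c : tours P1 n1 E1 -> tours P2 n2 E2 ->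
  (forall i j, i < a -> j < b -> P1 i j -> ~~ P2 i j) ->
  E1 (hedge phi i c) -> E2 (hedge phi i.+1 c) ->
  tours (fun i j => P1 i j || P2 i j) (n1 + n2)
    (fun e => [\/ E1 e /\ e != hedge phi i c, E2 e /\ e != hedge phi i.+1 c,
                 e = vedge phi i c | e = vedge phi i c.+1]).
Proof.
move=> [J1 [c1 s1 m1 E1P]] [J2 [c2 s2 m2 E2P]] dis /E1P e1 /E2P e2.
have [|J [cJ pJ k1 k2 /andP[v1 v2]]] :=
  merge_circuits c1 c2 _ e1 e2 (tor_adjv tor i c) (tor_adjv tor i c.+1).
  move=> v; have [i' [j' [lt_i lt_j ->]]] := tor_surj tor v.
  by rewrite m1 // m2 //; apply: dis.
exists J; split=> //.
- by rewrite (perm_size pJ) size_cat s1 s2.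
- by move=> i' j' lt_i lt_j; rewrite (perm_mem pJ) mem_cat m1 // m2.
by move=> e [[/E1P e' ?]|[/E2P e' ?]|->|->] //; [apply: k1 | apply: k2].
Qed.

Lemma tours_absorb P n E i c : tours P n E -> i.+1 < a -> c.+1 < b ->
  ~~ P i.+1 c -> ~~ P i.+1 c.+1 -> E (hedge phi i c) ->
  tours (fun i' j => P i' j || (i' == i.+1) && ((j == c) || (j == c.+1))) n.+2
    (fun e => E e /\ e != hedge phi i c \/ e = vedge phi i c).
Proof.
move=> [J [cJ sJ mJ eJ]] lt_i lt_c P1 P2 /eJ e.
have [||J' [cJ' pJ k /and3P[v1 v2 v3]]] := absorb_edge cJ e
  _ _ (tor_adjh tor i.+1 c) (tor_adjv tor i c) (tor_adjv tor i c.+1).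
- by rewrite mJ //; lia.
- by rewrite mJ.
exists J'; split=> //.
- by rewrite (perm_size pJ) size_cat sJ addn2.
- move=> i' j' lt_i' lt_j'; rewrite (perm_mem pJ) mem_cat mJ // !inE.
  have E0 c' : c' < b -> (phi i' j' == phi i.+1 c') = (i' == i.+1) && (j' == c').
    move=> lt_c'; apply/eqP/andP=> [/(tor_window tor)[]|[/eqP-> /eqP->]] //; try lia.
  by rewrite !E0 ?andb_orr //; lia.
by move=> d [[/eJ d' ?]|->] //; apply: k.
Qed.

(** Built column by column from a square: each new rung is absorbed along the
    last one, which disappears, so that both rails and the two outer rungs
    remain. *)
Lemma ladder i c k : 1 < k <= b -> exists J : seq G, [/\ circuit J, size J = k.*2,
   forall x, x \in J <-> exists t, t < k /\ (x = phi i (c + t) \/ x = phi i.+1 (c + t)),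
   forall t, t.+1 < k -> (hedge phi i (c + t) \in cycle_edges J)
                      && (hedge phi i.+1 (c + t) \in cycle_edges J)
   & (vedge phi i c \in cycle_edges J) && (vedge phi i (c + k.-1) \in cycle_edges J)].
Proof.
elim: k => [//|[|k] IH] // /andP[_ le_kb].
case: (posnP k) => [->|k_gt0].
  have [] := @square_circuit G (phi i c) (phi i c.+1) (phi i.+1 c.+1) (phi i.+1 c).
  - by rewrite /= !inE !negb_or !andbT;
      repeat (apply/andP; split); apply/eqP=> /(tor_window tor)[]; lia.
  - exact: (tor_adjh tor).
  - exact: (tor_adjv tor).
  - by rewrite adj_sym; apply: (tor_adjh tor).
  - by rewrite adj_sym; apply: (tor_adjv tor).
  move=> cJ /and4P[e1 e2 e3 e4]; eexists; split; first exact: cJ; first by [].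
  - move=> x; rewrite !inE; split.
      by case/or4P=> /eqP->; [exists 0 | exists 1 | exists 1 | exists 0];
        rewrite ?addn0 ?addn1; split=> //; auto.
    by case=> [] [|[|t]] [// _ []->]; rewrite ?addn0 ?addn1 eqxx ?orbT.
  - by case=> [|t] // _; rewrite addn0 e1 /= /hedge setUC e3.
  by rewrite addn1 {1}/vedge setUC e4 e2.
have [|J [cJ sJ mJ hJ /andP[v1 v2]]] := IH; first lia.
rewrite /= in v2; have out i' : i' = i \/ i' = i.+1 -> phi i' (c + k.+1) \notin J.
  move=> Hi'; apply/negP=> /mJ[t [lt_t [] /(tor_window tor)[]]]; lia.
have [||||J' [cJ' pJ k1 /and3P[h1 h2 v]]] := absorb_edge cJ v2 (out i _) (out i.+1 _)
  (tor_adjv tor i _) _ _; [by left|by right| | |].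
- by rewrite addnS; apply: (tor_adjh tor).
- by rewrite addnS; apply: (tor_adjh tor).
exists J'; split=> //.
- by rewrite (perm_size pJ) size_cat sJ addn2.
- move=> x; rewrite (perm_mem pJ) mem_cat !inE; split.
    case/or3P=> [/mJ[t [lt_t Ht]]|/eqP->|/eqP->]; first by exists t; split=> //; lia.
      by exists k.+1; auto.
    by exists k.+1; auto.
  case=> t [lt_t Ht]; case: (ltnP t k.+1) => [lt|ge].
    by apply/orP; left; apply/mJ; exists t.
  have Et : t = k.+1 by lia.
  by case: Ht => ->; rewrite Et eqxx ?orbT.
- move=> t lt_t; case: (ltnP t k) => [lt|ge].
    have /andP[e1 e2] := hJ t lt.
    by apply/andP; split; apply: k1 => //; apply: (hedge_neq_vedge tor); lia.
  by have -> : t = k by [lia]; rewrite /hedge -!addnS h1 h2.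
apply/andP; split=> //; apply: k1 => //; apply/eqP=> /(vedge_col_inj tor); lia.
Qed.

Definition in_rows i i' := (i' == i) || (i' == i.+1).

Lemma tours_ladder i k : i.+1 < a -> 1 < k <= b ->
  tours (fun i' j => in_rows i i' && (j < k)) k.*2
    (fun e => [\/ exists t, t.+1 < k /\ (e = hedge phi i t \/ e = hedge phi i.+1 t),
                 e = vedge phi i 0 | e = vedge phi i k.-1]).
Proof.
move=> lt_i le_k; have [J [cJ sJ mJ hJ /andP[v1 v2]]] := ladder i 0 le_k.
exists J; split=> // [i' j lt_i' lt_j|e].
  apply/idP/idP=> [/mJ[t [lt_t]]|/andP[Hi lt_jk]].
    by rewrite /in_rows; case=> /(tor_window tor)[]; lia.
  by apply/mJ; exists j; split=> //; case/orP: Hi => /eqP->; [left|right].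
case=> [[t [lt_t He]]|->|->] //.
by have := hJ t lt_t; rewrite add0n => /andP[]; case: He => ->.
Qed.

(** A full row pair is a ladder with [b] columns; [z] is the column where the
    prism is cut open. *)
Lemma tours_ring i z : i.+1 < a -> z < b ->
  tours (fun i' _ => in_rows i i') b.*2
    (fun e => [\/ exists c, [/\ c < b, c != z & e = hedge phi i c \/ e = hedge phi i.+1 c],
                 e = vedge phi i z | e = vedge phi i z.+1]).
Proof.
move=> lt_i lt_z; have bb : 1 < b <= b by lia.
have [J [cJ sJ mJ hJ /andP[v1 v2]]] := ladder i z.+1 bb.
exists J; split=> // [i' j lt_i' lt_j|e].
  apply/idP/idP=> [/mJ[t [lt_t]]|Hi].
    have [t' [lt_t' Et]] : exists t', t' < b /\ forall k, phi k (z.+1 + t) = phi k t'.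
      case: (ltnP (z.+1 + t) b) => [lt|ge]; first by exists (z.+1 + t).
      by exists (z.+1 + t - b); split=> [|k]; [lia | rewrite -[RHS](tor_col tor) subnK].
    by rewrite !Et /in_rows; case=> /(tor_window tor)[]; lia.
  have [t [lt_t Et]] : exists t, t < b /\ phi i' (z.+1 + t) = phi i' j.
    case: (ltnP z j) => [lt|ge]; first by exists (j - z.+1); rewrite subnKC //; split=> //; lia.
    exists (j + b - z.+1); split; first lia.
    by rewrite subnKC ?(tor_col tor) //; lia.
  by apply/mJ; exists t; split=> //; rewrite -Et; case/orP: Hi => /eqP->; [left|right].
case=> [[c [lt_c ne_c He]]|->|->] //; last first.
  by rewrite -(vedge_col tor); have -> : z + b = z.+1 + b.-1 by lia.
have [t [lt_t Et]] : exists t, t.+1 < b /\ forall k, hedge phi k c = hedge phi k (z.+1 + t).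
  case: (ltnP z c) => [lt|ge].
    by exists (c - z.+1); rewrite subnKC //; split=> //; lia.
  exists (c + b - z.+1); split=> [|k]; first lia.
  by rewrite subnKC ?(hedge_col tor) //; lia.
by have := hJ t lt_t; rewrite -!Et => /andP[]; case: He => ->.
Qed.

(** The edges of the tour of the first [h] row pairs in which every pair is cut
    open at column [z] and consecutive pairs are merged at column [w].  Merging
    destroys horizontal edges at [w] only between two pairs, not in the first or
    last row of the block, and it uses the vertical edges on both sides of
    [w]. *)
Definition stack_edge h z w (e : {set G}) : Prop :=
  [\/ exists i c, [/\ i < h.*2, c < b, c != z,
                     (c == w) ==> (i == 0) || (i == h.*2.-1) & e = hedge phi i c],
      exists2 i, i < h & e = vedge phi i.*2 z \/ e = vedge phi i.*2 z.+1
    | exists2 i, i.+1 < h & e = vedge phi i.*2.+1 w \/ e = vedge phi i.*2.+1 w.+1].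

Lemma tours_stack h z w : 0 < h -> h.*2 <= a -> z < b -> w < b -> w != z ->
  tours (fun i _ => i < h.*2) (h.*2 * b) (stack_edge h z w).
Proof.
move=> h_gt0 le_h lt_z lt_w ne_wz; elim: h h_gt0 le_h => [//|[_|h IH] _ le_h].
  apply: (tours_weaken (@tours_ring 0 z _ lt_z)); rewrite /in_rows //.
  - by move=> i j _ _; lia.
  - by lia.
  move=> e [[i [c [lt_i lt_c ne_c _ ->]]]|[i lt_i He]|[i]] //.
    constructor 1; exists c; split=> //.
    by have [->|->] : i = 0 \/ i = 1 by [lia]; [left|right].
  by case: i lt_i He => // _ []->; [constructor 2|constructor 3].
have lt_h : h.+1.*2.+1 < a by lia.
have le_h' : h.+1.*2 <= a by lia.
have hw : hedge phi h.+1.*2.-1 w = hedge phi h.*2.+1 w by [].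
have ne i c : i < h.+1.*2.+2 -> c < b -> (i != h.*2.+1) || (c != w) ->
    hedge phi i c != hedge phi h.*2.+1 w.
  by move=> ? ? ?; apply/eqP=> /(hedge_inj tor)[]; lia.
have ne' i c : i < h.+1.*2.+2 -> c < b -> (i != h.*2.+2) || (c != w) ->
    hedge phi i c != hedge phi h.*2.+2 w.
  by move=> ? ? ?; apply/eqP=> /(hedge_inj tor)[]; lia.
have nv i c k d : vedge phi i c != hedge phi k d.
  by rewrite eq_sym; apply: (hedge_neq_vedge tor); lia.
apply: (tours_weaken (tours_merge (i := h.*2.+1) (c := w)
  (IH isT le_h') (tours_ring lt_h lt_z) _ _ _)); rewrite /in_rows.
- by move=> i j _ _; lia.
- by constructor 1; exists h.*2.+1, w; rewrite eqxx; split=> //; lia.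
- by constructor 1; exists w; split=> //; left.
- by move=> i j _ _ /=; lia.
- by lia.
move=> e [[i [c [lt_i lt_c ne_c cw ->]]]|[i lt_i He]|[i lt_i He]].
- case: (ltnP i h.+1.*2) => [lt|ge].
    constructor 1; split; last by apply: ne => //; lia.
    by constructor 1; exists i, c; split=> //; lia.
  constructor 2; split; last by apply: ne' => //; lia.
  constructor 1; exists c; split=> //.
  by have [->|->] : i = h.+1.*2 \/ i = h.+1.*2.+1 by [lia]; [left|right].
- case: (ltnP i h.+1) => [lt|ge].
    by constructor 1; split; [constructor 2; exists i | case: He => ->].
  constructor 2; have Ei : i = h.+1 by lia.
  by split; [rewrite -Ei; case: He; [constructor 2|constructor 3] | case: He => ->].
case: (ltnP i.+1 h.+1) => [lt|ge].
  by constructor 1; split; [constructor 3; exists i | case: He => ->].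
by have <- : i = h by [lia]; case: He; [constructor 3|constructor 4].
Qed.

Definition band_edge h (e : {set G}) : Prop :=
  (exists i c, [/\ i < h.*2, c < b & e = hedge phi i c]) \/
  (exists i c, [/\ i.+1 < h.*2, c < b & e = vedge phi i c]).

(** The cut and the merges can be chosen so that the tour uses a prescribed
    edge: a horizontal one must avoid both, a rung must border the cut, a
    vertical edge between two pairs must border the merge.  Keeping the cut away
    from columns [0] and [b - 2] leaves the edges there free for attachments in
    the last row. *)
Lemma stack_edge_exists h e : 3 < b -> band_edge h e ->
  exists z w, [/\ z < b, w < b, w != z, (z != 0) && (z != b.-2) & stack_edge h z w e].
Proof.
move=> b_gt3 He.
have free c : exists z, [/\ z < b, z != c & (z != 0) && (z != b.-2)].
  by case: (eqVneq c 1) => [->|ne]; [exists b.-1 | exists 1]; split; lia.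
case: He => [[i [c [lt_i lt_c ->]]]|[i [c [lt_i lt_c ->]]]].
  have [z [lt_z ne_z z02]] := free c.
  have [w [lt_w ne_w wc]] : exists w, [/\ w < b, w != z & w != c].
    case: (eqVneq c 0) => [->|ne]; last by exists 0; split; lia.
    by case: (eqVneq z 1) => [->|ne]; [exists 2 | exists 1]; split; lia.
  exists z, w; split=> //.
  by constructor 1; exists i, c; split=> //; lia.
case: (boolP (odd i)) => [odd_i|even_i].
  have [z [lt_z ne_z z02]] := free c; exists z, c.
  split=> //; first by rewrite eq_sym.
  by constructor 3; exists i./2; [lia | left; congr vedge; lia].
have Ei : i = i./2.*2 by lia.
have [->|c0'] := eqVneq c 0.
  exists b.-1, 0; split; try lia.
  constructor 2; exists i./2; [lia | right].
  by rewrite prednK 1?[in RHS](_ : b = 0 + b) ?(vedge_col tor) -?Ei //; lia.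
have [->|c2] := eqVneq c b.-2.
  exists b.-2.-1, 0; split; try lia.
  by constructor 2; exists i./2; [lia | right; congr vedge; lia].
exists c, 0; split; try lia.
by constructor 2; exists i./2; [lia | left; congr vedge].
Qed.

(** A comb consists of [h] row pairs and [2 r] further cells of the next pair:
    [comb_top r] cells of its first and [comb_bot r] of its second row.  Usually
    these are [r] columns.  One column cannot be attached along a horizontal
    edge, so [r = 1] takes two cells of the first row instead; dually, for
    [r = b - 1] two cells of the second row are left out, so that the
    complement, seen from the other side, is the case [r = 1]. *)
Definition comb_top r := if r == 1 then 2 else if r == b.-1 then b else r.
Definition comb_bot r := if r == 1 then 0 else if r == b.-1 then b.-2 else r.

Definition comb h r i j :=
  [|| i < h.*2, (i == h.*2) && (j < comb_top r) | (i == h.*2.+1) && (j < comb_bot r)].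

(** The partial row pair is attached at column [0], and for [r = b - 1] its two
    extra cells at column [b - 2]; a prescribed edge of the row pairs survives
    unless it is one of the two edges removed there.  The attachment itself
    contributes the vertical edge of the last alternative. *)
Lemma tours_comb h r e : 3 < b -> 0 < h -> r < b -> h.*2 + (r != 0).*2 <= a ->
  [\/ r = 0 /\ band_edge h e,
      [/\ band_edge h e, e <> hedge phi h.*2.-1 0
        & r = b.-1 -> e <> hedge phi h.*2.-1 b.-2]
    | 0 < r /\ e = vedge phi h.*2.-1 0] ->
  tours (comb h r) (h.*2 * b + r.*2) (eq e).
Proof.
move=> b_gt3 h_gt0 lt_r le_a He.
have [z [w [lt_z lt_w ne_wz /andP[z0 z2] Hs]]] : exists z w,
    [/\ z < b, w < b, w != z, (z != 0) && (z != b.-2)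
      & [\/ r = 0 /\ stack_edge h z w e,
      [/\ stack_edge h z w e, e != hedge phi h.*2.-1 0
        & r = b.-1 -> e != hedge phi h.*2.-1 b.-2]
    | 0 < r /\ e = vedge phi h.*2.-1 0]].
  case: He => [[r0 band]|[band n1 n2]|link].
  - have [z [w [? ? ? ? ?]]] := stack_edge_exists b_gt3 band.
    by exists z, w; split=> //; constructor 1.
  - have [z [w [? ? ? ? ?]]] := stack_edge_exists b_gt3 band.
    exists z, w; split=> //; constructor 2; split=> //; first exact/eqP.
    by move=> /n2 ne; apply/eqP.
  by exists 1, 0; split; try lia; constructor 3.
case: h h_gt0 le_a He Hs => // h _ le_a _ Hs.
have le_h : h.+1.*2 <= a by lia.
have S := tours_stack (ltn0Sn h) le_h lt_z lt_w ne_wz.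
have att c : c < b -> c != z -> stack_edge h.+1 z w (hedge phi h.*2.+1 c).
  by move=> lt_c ne; constructor 1; exists h.*2.+1, c; split=> //; lia.
have a0 : stack_edge h.+1 z w (hedge phi h.*2.+1 0) by apply: att; lia.
have nv i c k d : vedge phi i c != hedge phi k d.
  by rewrite eq_sym; apply: (hedge_neq_vedge tor); lia.
have [r0|r_gt0] := posnP r.
  apply: (tours_weaken S); rewrite ?r0; try lia.
    by rewrite /comb /comb_top /comb_bot /= => i j _ _; case: ifP; lia.
  by move=> _ <-; case: Hs => [[_ ?]|[? _ _]|[r_gt0 _]] //; move: r_gt0; rewrite r0.
have [r1|r_ne1] := eqVneq r 1.
  apply: (tours_weaken (tours_absorb (i := h.*2.+1) (c := 0) S _ _ _ _ a0)); try lia.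
    by rewrite /comb /comb_top /comb_bot r1 /= => i j _ _; lia.
  move=> _ <-; case: Hs => [[]|[? ? _]|[_ ->]]; [lia | by left | by right].
(* [k] is the number of complete columns in the partial row pair. *)
pose k := if r == b.-1 then b.-2 else r.
have lt_k : 1 < k <= b by rewrite /k; case: ifP; lia.
have lt_h2 : h.*2.+3 < a by lia.
have M : tours (fun i j => (i < h.+1.*2) || in_rows h.*2.+2 i && (j < k))
    (h.+1.*2 * b + k.*2)
    (fun e => stack_edge h.+1 z w e /\ e != hedge phi h.*2.+1 0
              \/ e = vedge phi h.*2.+1 0).
  apply: (tours_weaken (tours_merge (i := h.*2.+1) (c := 0) S
    (tours_ladder lt_h2 lt_k) _ a0 _)) => //.
  - by rewrite /in_rows => i j _ _; lia.
  - by constructor 1; exists 0; split; [lia | left].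
  by move=> d [?|->]; [constructor 1 | constructor 3].
move: @k M lt_k; have [r2|r_ne2] := eqVneq r b.-1; move=> k M lt_k; last first.
  apply: (tours_weaken M) => //.
    rewrite /in_rows /comb /comb_top /comb_bot (negPf r_ne1) (negPf r_ne2) /k => i j _ _.
    by lia.
  move=> _ <-; case: Hs => [[]|[? ? _]|[_ ->]]; [lia | by left | by right].
have ne0 : hedge phi h.*2.+1 b.-2 != hedge phi h.*2.+1 0.
  by apply/eqP=> /(hedge_inj tor)[]; lia.
apply: (tours_weaken (tours_absorb (i := h.*2.+1) (c := b.-2) M _ _ _ _ _)); rewrite /in_rows /k; try lia.
- by left; split=> //; apply: att; lia.
- rewrite /in_rows /comb /comb_top /comb_bot (negPf r_ne1) r2 eqxx => i j _ _; lia.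
move=> _ <-; left.
by case: Hs => [[]|[se ne nr]|[_ ->]]; [lia | split; [left|apply: nr] | split; [right|exact: nv]].
Qed.
End Tours.

(** * Zigzags in a band of two rows *)

Section Zigzag.
Variables (G : sgraph) (a b : nat) (phi : nat -> nat -> G).
Hypotheses (tor : toroidal a b phi) (a_gt1 : 1 < a) (b_gt2 : 2 < b).

(** The path through [2 n] columns of rows 0 and 1 that runs down one column and
    up the next one; in contrast to a ladder it uses every rung. *)
Fixpoint zigzag n := if n is m.+1 then
  zigzag m ++ [:: phi 0 m.*2; phi 1 m.*2; phi 1 m.*2.+1; phi 0 m.*2.+1] else [::].

Lemma size_zigzag n : size (zigzag n) = n.*2.*2.
Proof. by elim: n => //= n IH; rewrite size_cat IH /=; lia. Qed.

Lemma mem_zigzag n x :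
  reflect (exists i j, [/\ i < 2, j < n.*2 & x = phi i j]) (x \in zigzag n).
Proof.
elim: n => [|n IH] /=; first by right; case=> i [j []].
apply: (iffP idP).
  rewrite mem_cat !inE => /orP[/IH[i [j [? ? ->]]]|].
    by exists i, j; split=> //; lia.
  by case/or4P=> /eqP->; [exists 0, n.*2|exists 1, n.*2|exists 1, n.*2.+1|exists 0, n.*2.+1];
    split=> //; lia.
case=> i [j [lt_i lt_j Ex]]; rewrite mem_cat; apply/orP.
case: (ltnP j n.*2) => [lt|ge]; first by left; apply/IH; exists i, j.
right; rewrite Ex !inE.
have [->|->] : j = n.*2 \/ j = n.*2.+1 by lia.
  by have [->|->] : i = 0 \/ i = 1 by [lia]; rewrite eqxx ?orbT.
by have [->|->] : i = 0 \/ i = 1 by [lia]; rewrite eqxx ?orbT.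
Qed.

Lemma zigzag_uniq n : n.*2 <= b -> uniq (zigzag n).
Proof.
elim: n => //= n IH le_n; rewrite cat_uniq IH ?andTb; last lia.
apply/andP; split.
  apply/hasPn=> x Hx; apply/negP=> /mem_zigzag[i [j [lt_i lt_j Ex]]].
  by move: Hx; rewrite !inE Ex; case/or4P=> /eqP/(tor_window tor)[]; lia.
by rewrite /= !inE !negb_or !andbT; repeat (apply/andP; split);
  apply/eqP=> /(tor_window tor)[]; lia.
Qed.

Lemma zigzag_path n : exists t, [/\ zigzag n.+1 = phi 0 0 :: phi 1 0 :: phi 1 1 :: t,
  path adj (phi 0 0) (behead (zigzag n.+1))
  & last (phi 0 0) (behead (zigzag n.+1)) = phi 0 n.*2.+1].
Proof.
elim: n => [|n [t [Et pt lt]]].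
  exists [:: phi 0 1]; split=> //=.
  by rewrite (tor_adjv tor) (tor_adjh tor) adj_sym (tor_adjv tor).
have E : zigzag n.+2 = zigzag n.+1 ++ [:: phi 0 n.+1.*2; phi 1 n.+1.*2;
  phi 1 n.+1.*2.+1; phi 0 n.+1.*2.+1] by [].
rewrite E; exists (t ++ [:: phi 0 n.+1.*2; phi 1 n.+1.*2;
  phi 1 n.+1.*2.+1; phi 0 n.+1.*2.+1]).
split; first by rewrite Et.
  rewrite Et in pt lt *; rewrite [behead _]/= -2!cat_cons cat_path pt lt /=.
  by rewrite !(tor_adjh tor) (tor_adjv tor) adj_sym (tor_adjv tor).
by rewrite Et /= last_cat.
Qed.

Lemma zigzag_rung n j : j < n.*2 -> exists s1 s2,
  zigzag n = s1 ++ [:: phi 0 j, phi 1 j & s2] \/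
  zigzag n = s1 ++ [:: phi 1 j, phi 0 j & s2].
Proof.
elim: n => // n IH lt_j /=; case: (ltnP j n.*2) => [/IH[s1 [s2 Es]]|ge].
  exists s1, (s2 ++ [:: phi 0 n.*2; phi 1 n.*2; phi 1 n.*2.+1; phi 0 n.*2.+1]).
  by case: Es => ->; [left|right]; rewrite -catA.
have [->|->] : j = n.*2 \/ j = n.*2.+1 by lia.
  by do 2!eexists; left.
by exists (zigzag n ++ [:: phi 0 n.*2; phi 1 n.*2]), [::]; right; rewrite -catA.
Qed.

Lemma zigzag_rung_edge J n s j : uniq J -> J = zigzag n ++ s -> j < n.*2 ->
  vedge phi 0 j \in cycle_edges J.
Proof.
move=> uJ EJ /zigzag_rung[s1 [s2 Es]].
case: Es EJ => ->; rewrite -catA => EJ; first exact: edge_consec EJ.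
by rewrite /vedge setUC; apply: edge_consec EJ.
Qed.

(** As [b] is even, the zigzag closes up around the prism. *)
Lemma tours_zigzag : ~~ odd b ->
  tours a b phi (fun i _ => i < 2) b.*2 (fun e => exists2 j, j < b & e = vedge phi 0 j).
Proof.
move=> even_b; have [n En] : exists n, b = n.+1.*2 by exists b./2.-1; lia.
have uJ : uniq (zigzag n.+1) by apply: zigzag_uniq; lia.
have [t [Et pt lt]] := zigzag_path n.
exists (zigzag n.+1); split.
- apply/and3P; split=> //; first by rewrite size_zigzag; lia.
  rewrite Et in pt lt *; rewrite /cycle rcons_path pt lt.
  by rewrite -[phi 0 0](tor_col tor) add0n En doubleS (tor_adjh tor).
- by rewrite size_zigzag; lia.
- move=> i j lt_i lt_j; apply/mem_zigzag/idP=> [[i' [j' [? ? /(tor_window tor)[]]]]|?]; try lia.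
  by exists i, j; split=> //; lia.
by move=> _ [j lt_j ->]; apply: (@zigzag_rung_edge _ n.+1 [::]); rewrite ?cats0 //; lia.
Qed.

(** Closing the zigzag through the last two cells of row 0 leaves out the two
    cells below them: this is the comb with [h = 0] and [r = b - 1]. *)
Lemma tours_zigzag_cut : ~~ odd b -> 3 < b ->
  tours a b phi (fun i j => (i == 0) || (i == 1) && (j < b.-2)) b.-1.*2
    (fun e => [\/ e = vedge phi 0 0, e = hedge phi 1 0 | e = hedge phi 0 b.-2]).
Proof.
move=> even_b b_gt3; have [n En] : exists n, b = n.+2.*2 by exists b./2.-2; lia.
have b1 : b.-1 = n.*2.+3 by lia.
have b2 : b.-2 = n.*2.+2 by lia.
have uZ : uniq (zigzag n.+1) by apply: zigzag_uniq; lia.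
have [t [Et pt lt]] := zigzag_path n.
pose J := zigzag n.+1 ++ [:: phi 0 n.*2.+2; phi 0 n.*2.+3].
have uJ : uniq J.
  rewrite cat_uniq uZ andTb; apply/andP; split; last first.
    by rewrite /= inE andbT; apply/eqP=> /(tor_window tor)[]; lia.
  apply/hasPn=> x Hx; apply/negP=> /mem_zigzag[i [j [lt_i lt_j Ex]]].
  by move: Hx; rewrite !inE Ex; case/orP=> /eqP/(tor_window tor)[]; lia.
exists J; split.
- apply/and3P; split=> //; first by rewrite size_cat size_zigzag; lia.
  rewrite /J Et; rewrite Et in pt lt; rewrite cat_cons /cycle rcons_path cat_path pt lt last_cat /=.
  by rewrite !(tor_adjh tor) /= -[phi 0 0](tor_col tor) add0n En !doubleS (tor_adjh tor).
- by rewrite size_cat size_zigzag /=; lia.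
- move=> i j lt_i lt_j; rewrite mem_cat !inE b2.
  have E0 c' : c' < b -> (phi i j == phi 0 c') = (i == 0) && (j == c').
    by move=> lt_c'; apply/eqP/andP=> [/(tor_window tor)[]|[/eqP-> /eqP->]] //; try lia.
  rewrite !E0; try lia.
  apply/orP/idP=> [[/mem_zigzag[i' [j' [? ? /(tor_window tor)[]]]]|]|?]; try lia.
  case: (ltnP j n.+1.*2) => [lt_jn|ge]; last by right; lia.
  by left; apply/mem_zigzag; exists i, j; split=> //; lia.
move=> _ [->|->|->].
- exact: (@zigzag_rung_edge _ n.+1 _ _ uJ erefl).
- by apply: (@edge_consec _ _ [:: phi 0 0]) => //; rewrite /J Et.
by rewrite b2; apply: (@edge_consec _ _ (zigzag n.+1) [::]).
Qed.

(** For [h = 0] there is nothing to attach to; the ladder or the zigzag takes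
    the place of the block.  The zigzag uses only every other horizontal edge,
    whence the exceptional column for edges of row 0. *)
Lemma tours_comb0 r e : ~~ odd b -> 3 < b -> 1 < r < b ->
  e = vedge phi 0 0 \/ (exists2 i, i < 2 &
    e = hedge phi i (if (r == b.-1) && (i == 0) then b.-2 else 0)) ->
  tours a b phi (comb b 0 r) r.*2 (eq e).
Proof.
move=> even_b b_gt3 lt_r He; have [r1|r_ne] := eqVneq r b.-1.
  apply: (tours_weaken (tours_zigzag_cut even_b b_gt3)); last 1 first.
  - move=> _ <-; case: He => [->|[i lt_i ->]]; first by constructor 1.
    by have [->|->] : i = 0 \/ i = 1 by [lia]; rewrite r1 eqxx; constructor.
  - by rewrite /comb /comb_top /comb_bot r1 eqxx => i j _ lt_j; case: ifP; lia.
  by rewrite r1.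
have le_r : 1 < r <= b by lia.
apply: (tours_weaken (tours_ladder (i := 0) tor _ _ _ le_r)) => //.
- by rewrite /in_rows /comb /comb_top /comb_bot (negPf r_ne) => i j _ _; case: ifP; lia.
move=> _ <-; case: He => [->|[i lt_i ->]]; first by constructor 2.
rewrite (negPf r_ne); constructor 1; exists 0; split; first lia.
by have [->|->] : i = 0 \/ i = 1 by [lia]; [left|right].
Qed.

End Zigzag.

(** * Symmetries of the torus and the split along rows *)

Section Symmetries.
Variables (G : sgraph) (a b : nat) (phi : nat -> nat -> G).
Hypothesis tor : toroidal a b phi.

Lemma toroidal_swap : toroidal b a (fun i j => phi j i).
Proof.
case: tor => rw cl av ah sj ij; split=> //.
  by move=> x; have [i [j [? ? ->]]] := sj x; exists j, i.
by move=> i j i' j' /ij[].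
Qed.

(** Symmetries are stated as the existence of another parametrization: all that
    matters is how the coordinates change. *)
Lemma toroidal_shift_rows c : exists psi : nat -> nat -> G,
  toroidal a b psi /\ forall i j, phi i j = psi (i + c) j.
Proof.
(* Translating back by [c] is adding [c (a - 1)], a natural number. *)
have back i j : phi (i + c + c * a.-1) j = phi i j.
  case: a tor => [T|a' T]; first by have [? [? []]] := tor_surj T (phi 0 0).
  apply: (tor_mod T); have -> : i + c + c * a'.+1.-1 = c * a'.+1 + i by rewrite /=; lia.
  by rewrite modnMDl.
exists (fun i j => phi (i + c * a.-1) j); split; last by move=> i j; rewrite back.
case: (tor) => rw cl av ah sj ij; split=> //.
- by move=> i j; rewrite addnAC rw.
- move=> x; have [i [j [lt_i lt_j ->]]] := sj x.
  exists ((i + c) %% a), j; split=> //; first by rewrite ltn_mod; lia.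
  by rewrite -[LHS]back; apply: (tor_mod tor); rewrite modnDml.
move=> i j i' j' /ij[E ->]; split=> //.
by move/eqP: E; rewrite eqn_modDr => /eqP.
Qed.

Lemma toroidal_flip_rows c : exists psi : nat -> nat -> G,
  toroidal a b psi /\ forall i i' j, i + i' = c %[mod a] -> phi i j = psi i' j.
Proof.
have flip i i' : 0 < a -> i + i' = c %[mod a] -> i = c + a.-1 * i' %[mod a].
  move=> a0 E; rewrite -modnDml -E modnDml.
  have -> : i + i' + a.-1 * i' = i' * a + i by nia.
  by rewrite modnMDl.
have a0 : 0 < a by have [i [j [lt_i _ _]]] := tor_surj tor (phi 0 0); lia.
exists (fun i j => phi (c + a.-1 * i) j); split; last first.
  by move=> i i' j E; apply: (tor_mod tor); apply: flip.
case: (tor) => rw cl av ah sj ij; split=> //.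
- move=> i j; apply: (tor_mod tor); rewrite mulnDr addnA.
  by rewrite addnC modnMDl.
- move=> i j; rewrite adj_sym.
  have -> : phi (c + a.-1 * i) j = phi (c + a.-1 * i.+1).+1 j; last exact: av.
  have -> : (c + a.-1 * i.+1).+1 = c + a.-1 * i + a by nia.
  by rewrite rw.
- move=> x; have [i [j [lt_i lt_j ->]]] := sj x.
  exists ((c + a.-1 * i) %% a), j; split=> //; first by rewrite ltn_mod.
  apply: (tor_mod tor); apply: flip => //.
  rewrite modnDmr; have -> : i + (c + a.-1 * i) = i * a + c by nia.
  by rewrite modnMDl.
move=> i j i' j' /ij[E ->]; split=> //.
have E2 : c + a.-1 * i + i + i' = c + a.-1 * i' + i + i' %[mod a].
  by apply/eqP; rewrite !eqn_modDr; apply/eqP.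
have F1 : c + a.-1 * i + i + i' = i * a + (c + i') by nia.
have F2 : c + a.-1 * i' + i + i' = i' * a + (c + i) by nia.
move: E2; rewrite F1 F2 !modnMDl => /eqP; rewrite eqn_modDl => /eqP ->.
by [].
Qed.

End Symmetries.

Section SymmetriesBoth.
Variables (G : sgraph) (a b : nat) (phi : nat -> nat -> G).
Hypothesis tor : toroidal a b phi.

Lemma toroidal_shift_cols c : exists psi : nat -> nat -> G,
  toroidal a b psi /\ forall i j, phi i j = psi i (j + c).
Proof.
have [psi [torp E]] := toroidal_shift_rows (toroidal_swap tor) c.
by exists (fun i j => psi j i); split; first exact: toroidal_swap.
Qed.

Lemma toroidal_rotation : exists psi : nat -> nat -> G, toroidal a b psi /\
  forall i i' j j', i + i' = a.-1 %[mod a] -> j + j' = b.-1 %[mod b] ->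
    phi i j = psi i' j'.
Proof.
have [psi [torp E]] := toroidal_flip_rows tor a.-1.
have [chi [torc F]] := toroidal_flip_rows (toroidal_swap torp) b.-1.
exists (fun i j => chi j i); split; first exact: toroidal_swap.
by move=> i i' j j' /E -> /F ->.
Qed.

End SymmetriesBoth.

Lemma hedge_modn (G : sgraph) a b (phi : nat -> nat -> G) i j : toroidal a b phi ->
  hedge phi i (j %% b) = hedge phi i j.
Proof.
move=> tor; rewrite /hedge; congr [set _; _]; apply: (tor_mod (toroidal_swap tor)).
  by rewrite modn_mod.
by rewrite -addn1 modnDml addn1.
Qed.

Lemma vedge_modn (G : sgraph) a b (phi : nat -> nat -> G) i j : toroidal a b phi ->
  vedge phi i (j %% b) = vedge phi i j.
Proof.
move=> tor; rewrite /vedge; congr [set _; _]; apply: (tor_mod (toroidal_swap tor));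
  by rewrite modn_mod.
Qed.

Definition splits (G : sgraph) (e f : {set G}) (l : nat) : Prop :=
  exists J1 J2 : seq G, [/\ circuit J1 && circuit J2,
    size J1 = l /\ size J2 = #|G| - l, {in J1, forall v, v \notin J2},
    e \in cycle_edges J1 & f \in cycle_edges J2].

Section Combs.
Variables (G : sgraph) (m b : nat).
Hypotheses (m_gt1 : 1 < m) (b_gt3 : 3 < b) (even_b : ~~ odd b).
Implicit Types (phi psi : nat -> nat -> G) (e f : {set G}).
Local Notation torus := (toroidal m.*2 b).
Local Notation tours := (tours m.*2 b).

(** The comb [(q, r)] and the half-turned comb [(m - q - 1, b - r)], or
    [(m - q, 0)] if [r = 0], are complementary. *)
Lemma splits_combs phi psi q r e f : torus phi -> torus psi ->
  (forall i i' j j', i + i' = m.*2.-1 %[mod m.*2] -> j + j' = b.-1 %[mod b] ->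
    phi i j = psi i' j') ->
  r < b -> q + (r != 0) <= m ->
  tours phi (comb b q r) (q.*2 * b + r.*2) (eq e) ->
  tours psi (comb b (m - q - (r != 0)) (if r == 0 then 0 else b - r))
    ((m - q - (r != 0)).*2 * b + (if r == 0 then 0 else b - r).*2) (eq f) ->
  splits e f (q * b + r).*2.
Proof.
move=> torp tors rot lt_r le_m [J1 [c1 s1 m1 e1]] [J2 [c2 s2 m2 e2]].
exists J1, J2; split; rewrite ?c1 ?e1 ?e2 //.
  split; first by rewrite s1; lia.
  rewrite s2 (card_torus torp); case: eqP le_m => [->|r0] /= le_m; nia.
move=> v; have [i [j [lt_i lt_j ->]]] := tor_surj torp v.
rewrite m1 // (rot i (m.*2.-1 - i) j (b.-1 - j)); try by [congr (_ %% _); lia].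
rewrite m2; try lia.
rewrite /comb /comb_top /comb_bot; case: (eqVneq r 0) le_m => [->|r0] /= le_m; first by case: ifP; lia.
case: (eqVneq r 1) => [->|r1]; first by case: ifP; try case: ifP; lia.
case: (eqVneq r b.-1) => [->|rb]; first by case: ifP; try case: ifP; lia.
by case: ifP; try case: ifP; lia.
Qed.

Definition in_band lo hi phi e : Prop :=
  (exists i v, [/\ lo <= i < hi, v < b & e = hedge phi i v]) \/
  (exists i v, [/\ lo <= i, i.+1 < hi, v < b & e = vedge phi i v]).

(** [tours_comb] for the second cycle, with the conditions on the prescribed
    edge read in the coordinates before the half turn. *)
Lemma tours_comb_rotated phi psi h r f : torus phi -> torus psi ->
  (forall i i' j j', i + i' = m.*2.-1 %[mod m.*2] -> j + j' = b.-1 %[mod b] ->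
    phi i j = psi i' j') ->
  0 < h -> r < b -> h + (r != 0) <= m ->
  [\/ in_band (m.*2 - h.*2) m.*2 phi f /\ (r != 0 ->
       (f <> hedge phi (m.*2 - h.*2) b.-2) /\
       (r = b.-1 -> f <> hedge phi (m.*2 - h.*2) 0))
    | 0 < r /\ f = vedge phi (m.*2 - h.*2).-1 b.-1] ->
  tours psi (comb b h r) (h.*2 * b + r.*2) (eq f).
Proof.
move=> torp tors rot h_gt0 lt_r le_m Hf.
have hE i i' v v' : i + i' = m.*2.-1 -> v + v'.+1 = b.-1 %[mod b] ->
    hedge phi i v = hedge psi i' v'.
  move=> Ei Ev; rewrite /hedge setUC (rot i i' v v'.+1) ?Ei // (rot i i' v.+1 v') ?Ei //.
  by rewrite addSnnS.
have vE i i' v v' : i + i'.+1 = m.*2.-1 -> v + v' = b.-1 %[mod b] ->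
    vedge phi i v = vedge psi i' v'.
  move=> Ei Ev; rewrite /vedge setUC (rot i i'.+1 v v') ?Ei // (rot i.+1 i' v v') //.
  by rewrite addSnnS Ei.
have wrap x : x = b.-1 + b -> x = b.-1 %[mod b] by move=> ->; rewrite modnDr.
apply: tours_comb => //; try lia.
case: Hf => [[band ne]|[r_gt0 ->]].
  have bd : band_edge b psi h f.
    case: band => [[i [v [lt_i lt_v ->]]]|[i [v [lt_i lt_i2 lt_v ->]]]].
      left; exists (m.*2.-1 - i), (if v == b.-1 then b.-1 else b.-2 - v).
      split; [lia | by case: ifP; lia |]; apply: hE; first lia.
      by case: ifP => [/eqP->|]; [apply: wrap; lia | move=> ?; congr (_ %% _); lia].
    right; exists (m.*2.-2 - i), (b.-1 - v); split; try lia.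
    by apply: vE; [lia | congr (_ %% _); lia].
  have [r0|r0] := eqVneq r 0; first by constructor 1.
  have [n1 n2] := ne r0; constructor 2; split=> //.
    by rewrite -(hE (m.*2 - h.*2) _ b.-2); [|lia|congr (_ %% _); lia].
  by move=> /n2; rewrite -(hE (m.*2 - h.*2) _ 0); [|lia|congr (_ %% _); lia].
constructor 3; split=> //; apply: vE; [lia | by rewrite addn0].
Qed.

(** Each congruence is violated by a single shift below [b], and [b > 3]. *)
Lemma fresh_shift x1 c1 x2 c2 x3 c3 : exists t, [/\ t < b, x1 + t != c1 %[mod b],
  x2 + t != c2 %[mod b] & x3 + t != c3 %[mod b]].
Proof.
pose bad x c := (c + b.-1 * x) %% b.
have badE x c t : t < b -> t != bad x c -> x + t != c %[mod b].
  move=> lt_t; apply: contraNneq => E; rewrite /bad -modnDml -E modnDml.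
  have -> : x + t + b.-1 * x = x * b + t by nia.
  by rewrite modnMDl modn_small.
have [t lt_t] := fresh_below (b_gt3 : size [:: bad x1 c1; bad x2 c2; bad x3 c3] < b).
rewrite !inE !negb_or => /and3P[n1 n2 n3].
by exists t; split=> //; apply: badE.
Qed.

Lemma in_band_shift phi psi t lo hi e : torus psi ->
  (forall i j, phi i j = psi i (j + t)) -> in_band lo hi phi e -> in_band lo hi psi e.
Proof.
move=> tor E [[i [v [? ? ->]]]|[i [v [? ? ? ->]]]].
  left; exists i, ((v + t) %% b); rewrite (hedge_modn _ _ tor) ltn_mod; split=> //; first lia.
  by rewrite /hedge !E.
right; exists i, ((v + t) %% b); rewrite (vedge_modn _ _ tor) ltn_mod; split=> //; first lia.
by rewrite /vedge !E.
Qed.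

(** The column of a horizontal edge, followed through translations; for a
    vertical edge the claim is void, so that both kinds can be treated alike. *)
Lemma column_of phi e hi : torus phi -> in_band 0 hi phi e -> hi <= m.*2 ->
  exists u, forall psi t i c, torus psi -> (forall i j, phi i j = psi i (j + t)) ->
    i < m.*2 -> c < b -> e = hedge psi i c -> u + t = c %[mod b].
Proof.
move=> tor [[k [v [? ? ->]]]|[k [v [? ? ? ->]]]] le_hi; last first.
  exists 0 => psi t i c tors E _ _ /esym/eqP.
  have -> : vedge phi k v = vedge psi k (v + t) by rewrite /vedge !E.
  by rewrite (negPf (hedge_neq_vedge tors _ _ _ _ _ _)) //; lia.
exists v => psi t i c tors E lt_i lt_c.
have -> : hedge phi k v = hedge psi k ((v + t) %% b) by rewrite (hedge_modn _ _ tors) /hedge !E.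
have lt_m : (v + t) %% b < b by rewrite ltn_mod; lia.
by move/(hedge_inj tors) => -[]; try lia; rewrite (modn_small lt_c).
Qed.

(** The case of at least one full row pair in the first comb.  Attaching the
    partial row pair excludes at most three positions of the columns relative to
    [e] and [f]; some translation avoids them all.  If [f] joins the partial row
    pair to the following one, it is obtained as an edge of the attachment, for
    which its column is prescribed; then [e] must not impose a condition, which
    is why it is required to be a rung. *)
Lemma splits_tall phi q r e f : torus phi -> 0 < q -> r < b -> q + (r != 0) < m ->
  in_band 0 2 phi e ->
  [\/ in_band (q + (r != 0)).*2 m.*2 phi f
    | [/\ r != 0, exists u, e = vedge phi 0 u & exists v, f = vedge phi q.*2.+1 v]] ->
  splits e f (q * b + r).*2.
Proof.
move=> tor q_gt0 lt_r lt_q He Hf.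
suff [psi [tors He' [Ce Hf']]] : exists psi, [/\ torus psi, in_band 0 2 psi e &
    (r != 0 -> e <> hedge psi q.*2.-1 0 /\ (r = b.-1 -> e <> hedge psi q.*2.-1 b.-2)) /\
    [\/ in_band (q + (r != 0)).*2 m.*2 psi f /\ (r != 0 ->
         f <> hedge psi q.+1.*2 b.-2 /\ (r = 1 -> f <> hedge psi q.+1.*2 0))
      | r != 0 /\ f = vedge psi q.*2.+1 b.-1]].
  have [chi [torc rot]] := toroidal_rotation tors.
  apply: (splits_combs tors torc rot) => //; first lia.
    apply: (tours_comb tors) => //; try lia.
    have bd : band_edge b psi q e.
      case: He' => [[i [v [? ? ->]]]|[i [v [? ? ? ->]]]]; [left|right];
        by exists i, v; split=> //; lia.
    have [r0|r0] := eqVneq r 0; first by constructor 1.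
    by have [n1 n2] := Ce r0; constructor 2.
  have Er : m.*2 - (m - q - (r != 0)).*2 = (q + (r != 0)).*2 by lia.
  apply: (tours_comb_rotated tors torc rot); try by move: lt_q lt_r; case: (eqVneq r 0) => [->|?] /=; lia.
  rewrite Er; case: Hf' => [[bf nf]|[r0 ->]]; [left; split=> // | right; split].
  - move: nf; case: (eqVneq r 0) => //= r0 nf _; have [//|n1 n2] := nf.
    by rewrite addn1; split=> // Erb; apply: n2; lia.
  - by rewrite (negPf r0); lia.
  by rewrite r0 addn1.
have shift t : exists psi, [/\ torus psi, in_band 0 2 psi e
    & forall i j, phi i j = psi i (j + t)].
  have [psi [tors E]] := toroidal_shift_cols tor t.
  by exists psi; split=> //; apply: in_band_shift He.
case: Hf => [band|[r0 [u Ee] [v Ef]]]; last first.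
  have [psi [tors He' E]] := shift (b.-1 - v %% b).
  exists psi; split=> //; split.
    have ne i j : e <> hedge psi i j.
      apply/eqP; rewrite eq_sym Ee.
      have -> : vedge phi 0 u = vedge psi 0 (u + (b.-1 - v %% b)) by rewrite /vedge !E.
      by apply: (hedge_neq_vedge tors); lia.
    by move=> _; split=> [|_]; apply: ne.
  right; split=> //; rewrite Ef -(vedge_modn _ _ tor) {1}/vedge !E subnKC //.
  by have := ltn_pmod v (ltnW (ltnW (ltnW b_gt3))); lia.
have [|u Hu] := column_of tor He; first lia.
have [||v Hv] := @column_of phi f m.*2 tor; last 1 first.
- have [t [_ te tf t3]] := fresh_shift u 0 v b.-2
    (if r == b.-1 then u else v) (if r == b.-1 then b.-2 else 0).
  have [psi [tors He' E]] := shift t.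
  exists psi; split=> //; split.
    move=> r0; split=> [/(Hu _ _ _ _ tors E)|rb /(Hu _ _ _ _ tors E)] H.
      by case/eqP: te; apply: H; lia.
    by move: t3; rewrite rb eqxx => /eqP[]; apply: H; lia.
  left; split; first exact: in_band_shift band.
  move=> r0; split=> [/(Hv _ _ _ _ tors E)|r1 /(Hv _ _ _ _ tors E)] H.
    by case/eqP: tf; apply: H; lia.
  move: t3; rewrite ifN; last lia.
  by rewrite ifN ?r1; [move=> /eqP[]; apply: H; lia | lia].
- by case: band => [[i [w [? ? ->]]]|[i [w [? ? ? ->]]]]; [left|right];
    exists i, w; split=> //; lia.
by [].
Qed.

(** The case of a first cycle inside the row pair of [e]: [e] is translated to
    where the ladder or the zigzag contains it.  The second cycle is attached
    along row 2, so [f] must not be a horizontal edge there. *)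
Lemma splits_short phi r e f : torus phi -> 1 < r < b -> in_band 0 2 phi e ->
  in_band 2 m.*2 phi f -> (forall v, v < b -> f <> hedge phi 2 v) -> splits e f r.*2.
Proof.
move=> tor lt_r He Hf nf.
have [psi [tors He' [Hf' nf']]] : exists psi, [/\ torus psi,
   e = vedge psi 0 0 \/ (exists2 i, i < 2 &
    e = hedge psi i (if (r == b.-1) && (i == 0) then b.-2 else 0))
   & in_band 2 m.*2 psi f /\ forall v, f <> hedge psi 2 v].
  have shift t : exists psi, [/\ torus psi, in_band 2 m.*2 psi f,
      forall v, f <> hedge psi 2 v & forall i j, phi i j = psi i (j + t)].
    have [psi [tors E]] := toroidal_shift_cols tor t.
    exists psi; split=> //; first exact: in_band_shift Hf.
    move=> v Ef; apply: (nf ((v + b.-1 * t) %% b)); first by rewrite ltn_mod; lia.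
    have -> : hedge phi 2 ((v + b.-1 * t) %% b) = hedge psi 2 (v + b.-1 * t + t).
      by rewrite (hedge_modn _ _ tor) /hedge !E.
    rewrite Ef -(hedge_modn _ v tors) -[RHS](hedge_modn _ _ tors).
    have -> : v + b.-1 * t + t = t * b + v by nia.
    by rewrite modnMDl.
  have to u c : u + (b - u %% b + c) = c %[mod b].
    rewrite addnA -modnDml; congr (_ %% _); rewrite -modnDml subnKC ?modnn //.
    by rewrite ltnW // ltn_mod; lia.
  case: He => [[i [u [lt_i lt_u ->]]]|[i [u [_ lt_i lt_u ->]]]].
    pose c := if (r == b.-1) && (i == 0) then b.-2 else 0.
    have [psi [tors Hf' nf' E]] := shift (b - u %% b + c); exists psi; split=> //.
    right; exists i => //; rewrite -/c -(hedge_modn _ c tors) -(to u) (hedge_modn _ _ tors).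
    by rewrite /hedge !E.
  have [psi [tors Hf' nf' E]] := shift (b - u %% b + 0); exists psi; split=> //.
  have -> : i = 0 by lia.
  by left; rewrite -(vedge_modn _ 0 tors) -(to u) (vedge_modn _ _ tors) /vedge !E.
have [chi [torc rot]] := toroidal_rotation tors.
have r0 : (r == 0) = false by lia.
apply: (splits_combs (q := 0) tors torc rot) => //; try lia.
  by rewrite /= mul0n add0n; apply: tours_comb0 => //; lia.
apply: (tours_comb_rotated tors torc rot); rewrite r0 /=; try lia.
have -> : m.*2 - (m - 0 - 1).*2 = 2 by lia.
by left; split=> // _; split=> [|_]; apply: nf'.
Qed.

(** The positions of [f] outside the row pair of [e] that can be handled:
    vertical edges between two row pairs, those with [i] odd, only if [e] is a
    rung. *)
Definition beyond phi e f : Prop :=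
  (exists i v, [/\ 2 <= i < m.*2, v < b & f = hedge phi i v]) \/
  (exists i v, [/\ 2 <= i, i.+1 < m.*2, v < b, odd i -> exists u, e = vedge phi 0 u
                 & f = vedge phi i v]).

Lemma beyond_band phi e f : beyond phi e f -> in_band 2 m.*2 phi f.
Proof.
by case=> [[i [v [? ? ->]]]|[i [v [? ? ? _ ->]]]]; [left|right]; exists i, v.
Qed.

(** Reflecting the torus in the middle of the first row pair. *)
Lemma flip_position phi e : torus phi -> in_band 0 2 phi e -> exists psi, [/\ torus psi,
  in_band 0 2 psi e, forall u, vedge phi 0 u = vedge psi 0 u,
  forall i v, 2 <= i < m.*2 -> hedge phi i v = hedge psi (m.*2.+1 - i) v
  & forall i v, 2 <= i < m.*2 -> vedge phi i v = vedge psi (m.*2 - i) v].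
Proof.
move=> tor He; have [psi [tors E]] := toroidal_flip_rows tor 1.
have small i i' j : i + i' = 1 -> phi i j = psi i' j.
  by move=> Ei; apply: E; rewrite Ei.
have large i i' j : i + i' = m.*2.+1 -> phi i j = psi i' j.
  by move=> Ei; apply: E; rewrite Ei -addn1 addnC modnDr.
have v0 u : vedge phi 0 u = vedge psi 0 u.
  by rewrite /vedge setUC (small 0 1) // (small 1 0).
exists psi; split=> //.
- case: He => [[i [u [lt_i lt_u ->]]]|[i [u [_ lt_i lt_u ->]]]].
    left; exists (1 - i), u; split=> //; first lia.
    by rewrite /hedge !(small i (1 - i)) //; lia.
  right; exists 0, u; split=> //; rewrite -v0; congr vedge; lia.
- by move=> i v lt_i; rewrite /hedge !(large i (m.*2.+1 - i)) //; lia.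
move=> i v lt_i; rewrite /vedge setUC.
by rewrite (large i.+1 (m.*2 - i)) ?(large i (m.*2 - i).+1) //; lia.
Qed.

(** Since [l] is at most half of the order, the first comb ends at the latest
    near the middle row; a reflection moves [f] to the far half.  In a first
    cycle inside one row pair the reflection is used instead to move [f] out of
    row 2. *)
Lemma splits_position phi k e f : torus phi -> in_band 0 2 phi e -> beyond phi e f ->
  1 < k -> k.*2 <= m * b -> splits e f k.*2.
Proof.
move=> tor He Hf k_gt1 le_k; case: (ltnP k b) => [lt_k|le_bk].
  have lt_k2 : 1 < k < b by lia.
  have high psi i v w : torus psi -> 2 < i < m.*2 -> v < b -> w < b ->
      hedge psi i v <> hedge psi 2 w.
    by move=> tors ? ? ? /(hedge_inj tors)[]; lia.
  have [psi [tors He' v0 hE vE]] := flip_position tor He.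
  case: (Hf) => [[i [v [lt_i lt_v Ef]]]|[i [v [lt_i lt_i2 lt_v _ Ef]]]].
    have [i2|i2] := eqVneq i 2; last first.
      apply: (splits_short tor) => // [|w lt_w]; first exact: beyond_band Hf.
      by rewrite Ef; apply: high => //; lia.
    apply: (splits_short tors) => // [|w lt_w].
      by left; exists (m.*2.+1 - i), v; split=> //; [lia | rewrite Ef hE].
    by rewrite Ef hE //; apply: high => //; lia.
  apply: (splits_short tor) => // [|w lt_w]; first exact: beyond_band Hf.
  by apply/eqP; rewrite Ef eq_sym; apply: (hedge_neq_vedge tor); lia.
pose q := k %/ b; pose r := k %% b.
have Ek : k = q * b + r := divn_eq k b.
have lt_r : r < b by rewrite ltn_mod; lia.
have q_gt0 : 0 < q by rewrite divn_gt0 //; lia.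
have le_q : q.*2 + (r != 0) <= m by case: (eqVneq r 0) => r0; nia.
have done_f psi : torus psi -> in_band 0 2 psi e ->
    (exists i v, [/\ m < i < m.*2, v < b & f = hedge psi i v]) \/
    (exists i v, [/\ m <= i, i.+1 < m.*2, v < b, odd i -> exists u, e = vedge psi 0 u
                   & f = vedge psi i v]) -> splits e f k.*2.
  move=> tors He' Hf'; rewrite Ek; apply: (splits_tall tors) => //.
    by case: (eqVneq r 0) le_q => ?; lia.
  case: Hf' => [[i [v [lt_i lt_v Ef]]]|[i [v [lt_i lt_i2 lt_v ov Ef]]]].
    left; left; exists i, v; split=> //; lia.
  case: (leqP (q + (r != 0)).*2 i) => [le_i|gt_i]; first by left; right; exists i, v.
  have [r_nz Ei] : r != 0 /\ i = q.*2.+1 by lia.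
  right; split=> //; first by apply: ov; lia.
  by exists v; rewrite Ef Ei.
have [psi [tors He' v0 hE vE]] := flip_position tor He.
case: Hf => [[i [v [lt_i lt_v Ef]]]|[i [v [lt_i lt_i2 lt_v ov Ef]]]].
  case: (ltnP m i) => [lt_mi|ge_mi].
    by apply: (done_f phi) => //; left; exists i, v; split=> //; lia.
  by apply: (done_f psi) => //; left; exists (m.*2.+1 - i), v; rewrite -hE //; split=> //; lia.
case: (leqP m i) => [lt_mi|ge_mi].
  by apply: (done_f phi) => //; right; exists i, v.
apply: (done_f psi) => //; right; exists (m.*2 - i), v; rewrite -vE; last lia.
split=> //; try lia.
by move=> oi; have [|u ->] := ov; [lia | exists u].
Qed.

End Combs.

(** * Two independent edges of an even torus *)

Section Placement.
Variables (G : sgraph) (a b : nat) (phi : nat -> nat -> G).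
Hypothesis tor : toroidal a b phi.

Lemma toroidal_place x r : exists psi : nat -> nat -> G, toroidal a b psi /\
  forall d j, phi (x + d) j = psi (r + d) j.
Proof.
have a0 : 0 < a by have [i [j [lt_i _ _]]] := tor_surj tor (phi 0 0); lia.
have [psi [tors E]] := toroidal_shift_rows tor (a - x %% a + r).
exists psi; split=> // d j; rewrite E; apply: (tor_mod tors).
rewrite -addnA -modnDml.
have -> : x %% a + (d + (a - x %% a + r)) = r + d + a.
  by have := ltn_pmod x a0; lia.
by rewrite modnDr.
Qed.

Lemma row_offset x y : exists d, d < a /\ forall j, phi y j = phi (x + d) j.
Proof.
have a0 : 0 < a by have [i [j [lt_i _ _]]] := tor_surj tor (phi 0 0); lia.
exists ((y + a.-1 * x) %% a); split=> [|j]; first by rewrite ltn_mod.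
apply: (tor_mod tor); rewrite modnDmr.
have -> : x + (y + a.-1 * x) = x * a + y by nia.
by rewrite modnMDl.
Qed.

Lemma hedge_offset x y : exists d, d < a /\ forall j, hedge phi y j = hedge phi (x + d) j.
Proof.
by have [d [lt_d E]] := row_offset x y; exists d; split=> // j; rewrite /hedge !E.
Qed.

Lemma vedge_offset x y : exists d, d < a /\ forall j, vedge phi y j = vedge phi (x + d) j.
Proof.
have [d [lt_d E]] := row_offset x y; exists d; split=> // j; rewrite /vedge E.
congr [set _; _]; have [F _] := tor_inj tor (E j).
by apply: (tor_mod tor); rewrite -addn1 -modnDml F modnDml addn1.
Qed.

End Placement.

Section Splitting.
Variables (G : sgraph) (k : nat).
Hypotheses (k_gt1 : 1 < k) (le_k : k.*2.*2 <= #|G|).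
Implicit Types (phi psi : nat -> nat -> G) (e f : {set G}).

Definition even4 n := ~~ odd n && (3 < n).

Lemma splits_placed a b phi e f : even4 a -> even4 b -> toroidal a b phi ->
  (exists i u, i < 2 /\ e = hedge phi i u) \/ (exists u, e = vedge phi 0 u) ->
  (exists i v, 2 <= i < a /\ f = hedge phi i v) \/
  (exists i v, [/\ 2 <= i, i.+1 < a, odd i -> exists u, e = vedge phi 0 u
                 & f = vedge phi i v]) ->
  splits e f k.*2.
Proof.
case/andP=> even_a a4 /andP[even_b b4] tor He Hf.
have [m Ea] : exists m, a = m.*2 by exists a./2; lia.
have Ek := card_torus tor; subst a.
have b0 : 0 < b by lia.
have lek : k.*2 <= m * b by rewrite -leq_double doubleMl -Ek.
apply: (splits_position _ _ _ tor) => //; try lia.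
  case: He => [[i [u [lt_i ->]]]|[u ->]].
    by left; exists i, (u %% b); rewrite (hedge_modn _ _ tor) ?ltn_mod //.
  by right; exists 0, (u %% b); rewrite (vedge_modn _ _ tor) ?ltn_mod //.
case: Hf => [[i [v [lt_i ->]]]|[i [v [lt_i lt_i2 ov ->]]]]; [left|right].
  by exists i, (v %% b); rewrite (hedge_modn _ _ tor) ?ltn_mod //.
by exists i, (v %% b); rewrite (vedge_modn _ _ tor) ?ltn_mod //.
Qed.

Section Cases.
Variables (a b : nat) (phi : nat -> nat -> G).
Hypotheses (even_a : even4 a) (even_b : even4 b) (tor : toroidal a b phi).

(** Usually [e] is put into row 0; if [f] lies in the next row, [e] is put into
    row 1 instead, so that the two get into different row pairs. *)
Lemma splits_hh x d u v : 0 < d < a ->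
  splits (hedge phi x u) (hedge phi (x + d) v) k.*2.
Proof.
move=> lt_d; pose r := (d == 1) : nat; have [psi [tors E]] := toroidal_place tor x r.
have hE d' j : hedge phi (x + d') j = hedge psi (r + d') j by rewrite /hedge !E.
apply: (splits_placed even_a even_b tors).
  by left; exists r, u; rewrite -(addn0 x) hE addn0; split=> //; rewrite /r; lia.
left; exists (r + d), v; rewrite hE; split=> //.
by move/andP: even_a; rewrite /r; lia.
Qed.

(** The parity of [d] decides whether [e] is put into row 0 or row 1, so that [f]
    becomes a rung. *)
Lemma splits_hv x d u v : 0 < d < a.-1 ->
  splits (hedge phi x u) (vedge phi (x + d) v) k.*2.
Proof.
move=> lt_d; pose r := odd d : nat; have [psi [tors E]] := toroidal_place tor x r.
have hE d' j : hedge phi (x + d') j = hedge psi (r + d') j by rewrite /hedge !E.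
have vE d' j : vedge phi (x + d') j = vedge psi (r + d') j.
  by rewrite /vedge -!addnS !E.
apply: (splits_placed even_a even_b tors).
  by left; exists r, u; rewrite -(addn0 x) hE addn0; split=> //; rewrite /r; lia.
right; exists (r + d), v; rewrite vE.
by move/andP: even_a => [ea a4]; split=> //; rewrite /r; lia.
Qed.

Lemma splits_vh x d u v : 1 < d < a ->
  splits (vedge phi x u) (hedge phi (x + d) v) k.*2.
Proof.
move=> lt_d; have [psi [tors E]] := toroidal_place tor x 0.
have hE d' j : hedge phi (x + d') j = hedge psi d' j by rewrite /hedge !E.
have vE d' j : vedge phi (x + d') j = vedge psi d' j.
  by rewrite /vedge -!addnS !E.
apply: (splits_placed even_a even_b tors).
  by right; exists u; rewrite -(addn0 x) vE.
by left; exists d, v; rewrite hE.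
Qed.

(** For odd [d] the edge [f] lies between two row pairs, which is admissible as
    [e] is a rung. *)
Lemma splits_vv x d u v : 1 < d < a.-1 ->
  splits (vedge phi x u) (vedge phi (x + d) v) k.*2.
Proof.
move=> lt_d; have [psi [tors E]] := toroidal_place tor x 0.
have vE d' j : vedge phi (x + d') j = vedge psi d' j.
  by rewrite /vedge -!addnS !E.
have Ee : vedge phi x u = vedge psi 0 u by rewrite -(addn0 x) vE.
apply: (splits_placed even_a even_b tors); first by right; exists u.
right; exists d, v; rewrite vE; split=> //; try lia.
by exists u.
Qed.

End Cases.

Definition on_torus phi e : Prop :=
  exists i j, e = hedge phi i j \/ e = vedge phi i j.

Lemma disjoint_common e f x : [disjoint e & f] -> x \in e -> x \in f -> False.
Proof. by move=> /pred0P/(_ x)/= /andP H *; apply: H. Qed.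

(** If rows cannot separate [e] and [f], then, the edges being independent,
    columns can, and the axes are swapped. *)
Lemma splits_h a b phi e f x u : even4 a -> even4 b -> toroidal a b phi ->
  e = hedge phi x u -> on_torus phi f -> [disjoint e & f] -> splits e f k.*2.
Proof.
move=> ea eb tor Ee Of dis.
have torS := toroidal_swap tor; pose psi i j := phi j i.
have a4 := andP ea; have b4 := andP eb.
case: Of => y [v [Ef|Ef]].
  have [d [lt_d E]] := hedge_offset tor x y; rewrite E in Ef.
  have [d0|d_gt0] := posnP d; last first.
    by rewrite Ee Ef; apply: (splits_hh ea eb tor); rewrite d_gt0.
  rewrite d0 addn0 in Ef.
  have [d' [lt_d' F]] := vedge_offset torS u v.
  have Ee' : e = vedge psi u x by [].
  have Ef' : f = vedge psi (u + d') x by rewrite -F.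
  rewrite Ee' Ef'; apply: (splits_vv eb ea torS).
  rewrite Ee' Ef' in dis.
  have [d0'|d0'] := eqVneq d' 0.
    by case: (disjoint_common (x := psi u x) dis); rewrite ?d0' ?addn0 /vedge !inE eqxx.
  have [d1|d1] := eqVneq d' 1.
    by case: (disjoint_common (x := psi u.+1 x) dis); rewrite ?d1 ?addn1 /vedge !inE eqxx ?orbT.
  have [d2|d2] := eqVneq d' b.-1; last by lia.
  case: (disjoint_common (x := psi u x) dis); rewrite /vedge !inE ?eqxx //.
  have -> : (u + d').+1 = u + b by lia.
  by rewrite /psi (tor_col tor) eqxx orbT.
have [d [lt_d E]] := vedge_offset tor x y; rewrite E in Ef.
have [lt|ge] := boolP (0 < d < a.-1).
  by rewrite Ee Ef; apply: (splits_hv ea eb tor).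
have xf : phi x v \in f.
  rewrite Ef /vedge !inE; have [->|->] : d = 0 \/ d = a.-1 by lia.
    by rewrite addn0 eqxx.
  have -> : (x + a.-1).+1 = x + a by lia.
  by rewrite (tor_row tor) eqxx orbT.
have [d' [lt_d' F]] := row_offset torS u v.
have Ee' : e = vedge psi u x by [].
have Ef' : f = hedge psi (u + d') (x + d) by rewrite Ef /vedge /hedge /psi -!F.
rewrite Ee' Ef'; apply: (splits_vh eb ea torS).
have [//|le_d'] := boolP (1 < d' < b).
have [] := disjoint_common (x := phi x v) dis; last exact: xf.
rewrite Ee /hedge !inE (F x).
have [->|->] : d' = 0 \/ d' = 1 by lia.
  by rewrite addn0 eqxx.
by rewrite addn1 eqxx orbT.
Qed.

Lemma splits_torus a b phi e f : even4 a -> even4 b -> toroidal a b phi ->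
  on_torus phi e -> on_torus phi f -> [disjoint e & f] -> splits e f k.*2.
Proof.
move=> ea eb tor [x [u [Ee|Ee]]] Of dis; first exact: (splits_h ea eb tor Ee).
have torS := toroidal_swap tor; apply: (splits_h (u := x) (x := u) eb ea torS) => //.
by case: Of => y [v [?|?]]; exists v, y; [right|left].
Qed.

End Splitting.

(** * The cube *)

Section Cube.
Variables (G : sgraph) (phi : nat -> nat -> G).
Hypothesis tor : toroidal 2 4 phi.

(** The edges of the face over columns [c] and [c + 1]; the opposite face is the
    one over [c + 2] and [c + 3]. *)
Definition slab_edge c (e : {set G}) : Prop :=
  exists i, [\/ e = hedge phi i c, e = vedge phi i c | e = vedge phi i c.+1].

Lemma row_parity i : (forall j, phi i j = phi 0 j /\ phi i.+1 j = phi 1 j) \/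
  (forall j, phi i j = phi 1 j /\ phi i.+1 j = phi 0 j).
Proof.
have eq_row k k' j : odd k = odd k' -> phi k j = phi k' j.
  by move=> E; apply: (tor_mod tor); rewrite !modn2 E.
by case: (boolP (odd i)) => oi; [right|left] => j; split; apply: eq_row; lia.
Qed.

Lemma vedge_0 i j : vedge phi i j = vedge phi 0 j.
Proof.
rewrite /vedge; case: (row_parity i) => /(_ j)[-> ->] //.
exact: setUC.
Qed.

Lemma splits_slabs c e f : slab_edge c e -> slab_edge c.+2 f -> splits e f 4.
Proof.
move=> He Hf.
have slab c' : exists J : seq G, [/\ circuit J, size J = 4,
    forall x, x \in J -> exists i t, [/\ i < 2, t < 2 & x = phi i (c' + t)]
    & forall d, slab_edge c' d -> d \in cycle_edges J].
  have [] := @ladder G 2 4 phi tor isT isT 0 c' 2 isT.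
  move=> J [cJ sJ mJ hJ /andP[v0 v1]]; exists J; split=> //.
    by move=> x /mJ[t [lt_t [->|->]]]; [exists 0, t | exists 1, t].
  have := hJ 0 isT; rewrite addn0 => /andP[h0 h1].
  move=> d [i [->|->|->]].
  - by rewrite /hedge; case: (row_parity i) => E; rewrite !(E _).1.
  - by rewrite vedge_0.
  by rewrite vedge_0 -addn1.
have [J1 [c1 s1 m1 e1]] := slab c; have [J2 [c2 s2 m2 e2]] := slab c.+2.
exists J1, J2; split; [exact/andP | | | exact: e1 | exact: e2].
  by rewrite s1 s2 (card_torus tor).
move=> v /m1[i [t [? ? ->]]]; apply/negP=> /m2[i' [t' [? ?]]].
by case/(tor_window tor); lia.
Qed.

Lemma splits_rows x u v : splits (hedge phi x u) (hedge phi x.+1 v) 4.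
Proof.
have row i : exists J : seq G, [/\ circuit J, size J = 4,
    forall y, y \in J -> exists2 t, t < 4 & y = phi i t
    & forall j, hedge phi i j \in cycle_edges J].
  have [] := @square_circuit G (phi i 0) (phi i 1) (phi i 2) (phi i 3).
  - by rewrite /= !inE !negb_or !andbT;
      repeat (apply/andP; split); apply/eqP=> /(tor_window tor)[]; lia.
  - exact: (tor_adjh tor).
  - exact: (tor_adjh tor).
  - exact: (tor_adjh tor).
  - by have := tor_adjh tor i 3; rewrite (tor_col tor i 0).
  move=> cJ /and4P[e1 e2 e3 e4]; eexists; split; first exact: cJ; first by [].
    move=> y; rewrite !inE => /or4P[] /eqP ->;
    by [exists 0 | exists 1 | exists 2 | exists 3].
  move=> j; rewrite -(hedge_modn _ _ tor).
  have : j %% 4 < 4 by rewrite ltn_mod.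
  case: (j %% 4) => [|[|[|[|//]]]] _ //.
  by rewrite /hedge (tor_col tor i 0).
have [J1 [c1 s1 m1 e1]] := row x; have [J2 [c2 s2 m2 e2]] := row x.+1.
exists J1, J2; split; [exact/andP | | | exact: e1 | exact: e2].
  by rewrite s1 s2 (card_torus tor).
move=> w /m1[t ? ->]; apply/negP=> /m2[t' ?].
by case/(tor_window tor); lia.
Qed.

(** Independent edges lie on opposite faces: parallel ones differ in a
    coordinate, others differ in the coordinate that neither of them changes. *)
Lemma splits_cube e f : on_torus phi e -> on_torus phi f -> [disjoint e & f] -> splits e f 4.
Proof.
have torS := toroidal_swap tor.
move=> [x [u He]] [y [v0 Hf0]] dis.
have [d [lt_d Ev]] : exists d, d < 4 /\ (f = hedge phi y (u + d) \/ f = vedge phi y (u + d)).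
  case: Hf0 => ->; [have [d [? E]] := vedge_offset torS u v0
                   | have [d [? E]] := hedge_offset torS u v0]; exists d; split=> //.
    by left; apply: E.
  by right; apply: E.
have no z : z \in e -> z \in f -> False by apply: disjoint_common.
have wrap i : phi i (u + 3).+1 = phi i u by rewrite -addnS (tor_col tor).
have hw i : hedge phi i (u + 3).+2 = hedge phi i u.+1.
  by have -> : (u + 3).+2 = u.+1 + 4 by [lia]; rewrite (hedge_col tor).
have h2w i : hedge phi i (u + 3).+3 = hedge phi i u.+2.
  by have -> : (u + 3).+3 = u.+2 + 4 by [lia]; rewrite (hedge_col tor).
have vw i : vedge phi i (u + 3).+1 = vedge phi i u.
  by rewrite -addnS (vedge_col tor).
have v2w i : vedge phi i (u + 3).+2 = vedge phi i u.+1.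
  by have -> : (u + 3).+2 = u.+1 + 4 by [lia]; rewrite (vedge_col tor).
case: He Ev => Ee [] Ef.
- case: (boolP (odd x == odd y)) => par.
    have E j : phi y j = phi x j by apply: (tor_mod tor); rewrite !modn2 (eqP par).
    have Ef' : f = hedge phi x (u + d) by rewrite Ef /hedge !E.
    have [d0|] := eqVneq d 0.
      by case: (no (phi x u)); rewrite ?Ee ?Ef' ?d0 ?addn0 /hedge !inE eqxx.
    have [d1|] := eqVneq d 1.
      by case: (no (phi x u.+1)); rewrite ?Ee ?Ef' ?d1 ?addn1 /hedge !inE eqxx ?orbT.
    have [d3|] := eqVneq d 3.
      by case: (no (phi x u)); rewrite ?Ee ?Ef' ?d3 /hedge !inE ?wrap eqxx ?orbT.
    move=> ? ? ?; have d2 : d = 2 by lia.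
    by apply: (@splits_slabs u); exists x; [rewrite Ee|rewrite Ef' d2 addn2]; constructor 1.
  have Ef' : f = hedge phi x.+1 (u + d).
    rewrite Ef /hedge; congr [set _; _]; apply: (tor_mod tor); rewrite !modn2 /=;
    by case: (odd x) (odd y) par => [] [].
  by rewrite Ee Ef'; apply: splits_rows.
- have xf z : z = phi x (u + d) -> z \in f.
    rewrite Ef vedge_0 -(vedge_0 x) => ->; by rewrite !inE eqxx.
  have [d0|] := eqVneq d 0.
    by case: (no (phi x u)); rewrite ?xf ?d0 ?addn0 // Ee !inE eqxx.
  have [d1|] := eqVneq d 1.
    by case: (no (phi x u.+1)); rewrite ?xf ?d1 ?addn1 // Ee !inE eqxx orbT.
  move=> ? ?; apply: (@splits_slabs u); first by exists x; constructor 1.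
  exists y; have [d2|d3] : d = 2 \/ d = 3 by lia.
    by constructor 2; rewrite Ef d2 addn2.
  by constructor 3; rewrite Ef d3 addn3.
- have xe z : z = phi y u -> z \in e.
    rewrite Ee vedge_0 -(vedge_0 y) => ->; by rewrite !inE eqxx.
  have [d0|] := eqVneq d 0.
    by case: (no (phi y u)); rewrite ?xe ?Ef ?d0 ?addn0 // !inE eqxx.
  have [d3|] := eqVneq d 3.
    by case: (no (phi y u)); rewrite ?xe ?Ef ?d3 // !inE wrap eqxx orbT.
  move=> ? ?; have [d1|d2] : d = 1 \/ d = 2 by lia.
    apply: (@splits_slabs (u + 3)); first by exists x; constructor 3; rewrite vw.
    by exists y; constructor 1; rewrite hw Ef d1 addn1.
  apply: (@splits_slabs u); first by exists x; constructor 2.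
  by exists y; constructor 1; rewrite Ef d2 addn2.
have [d0|] := eqVneq d 0.
  case: (no (phi 0 u)); rewrite ?Ee ?Ef ?d0 ?addn0 vedge_0 !inE eqxx //.
have [d1|] := eqVneq d 1.
  move=> _; apply: (@splits_slabs (u + 3)); first by exists x; constructor 3; rewrite vw.
  by exists y; constructor 2; rewrite v2w Ef d1 addn1.
move=> ? ?; apply: (@splits_slabs u); first by exists x; constructor 2.
exists y; have [d2|d3] : d = 2 \/ d = 3 by lia.
  by constructor 2; rewrite Ef d2 addn2.
by constructor 3; rewrite Ef d3 addn3.
Qed.

End Cube.

(** * Two edges on a Hamiltonian cycle *)

Section TwoEdges.
Variable G : sgraph.
Implicit Types (phi psi : nat -> nat -> G) (e f : {set G}).

Definition ham_circuit e f : Prop := exists J : seq G,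
  [/\ circuit J, size J = #|G|, e \in cycle_edges J & f \in cycle_edges J].

Lemma ham_circuitC e f : ham_circuit e f -> ham_circuit f e.
Proof. by case=> J [? ? ? ?]; exists J. Qed.

Lemma ham_stack m b phi z w e f : toroidal m.*2 b phi -> 0 < m -> 3 < b ->
  z < b -> w < b -> w != z ->
  stack_edge b phi m z w e -> stack_edge b phi m z w f -> ham_circuit e f.
Proof.
move=> tor m0 b4 lt_z lt_w ne He Hf.
have [||J [cJ sJ _ eJ]] := @tours_stack G m.*2 b phi tor _ _ m z w m0 (leqnn _) lt_z lt_w ne.
- by lia.
- by lia.
by exists J; split; rewrite ?(card_torus tor) //; apply: eJ.
Qed.

Lemma fresh3 b x y t : 3 < b -> exists z, [/\ z < b, z != x, z != y & z != t].
Proof.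
move=> b4; have [z lt_z] := fresh_below (b4 : size [:: x; y; t] < b).
by rewrite !inE !negb_or => /and3P[? ? ?]; exists z.
Qed.

Section Cases.
Variables (m b : nat) (phi : nat -> nat -> G).
Hypotheses (tor : toroidal m.*2 b phi) (m_gt0 : 0 < m) (b_gt3 : 3 < b).

Lemma hedge_red i u : exists i' u', [/\ i' < m.*2, u' < b & hedge phi i u = hedge phi i' u'].
Proof.
have [d [lt_d E]] := hedge_offset tor 0 i; exists d, (u %% b).
by rewrite (hedge_modn _ _ tor) ltn_mod E; split=> //; lia.
Qed.

Lemma ham_hh i u k v : ham_circuit (hedge phi i u) (hedge phi k v).
Proof.
have [i' [u' [lt_i lt_u ->]]] := hedge_red i u.
have [k' [v' [lt_k lt_v ->]]] := hedge_red k v.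
have [z [lt_z zu zv _]] := fresh3 u' v' 0 b_gt3.
have [w [lt_w wz wu wv]] := fresh3 z u' v' b_gt3.
apply: (ham_stack tor) lt_z lt_w wz _ _ => //.
  by constructor 1; exists i', u'; split=> //; lia.
by constructor 1; exists k', v'; split=> //; lia.
Qed.

End Cases.

(** The vertical edge is translated into a row pair, where it can border the
    cut. *)
Lemma ham_hv m b phi i u k v : toroidal m.*2 b phi -> 0 < m -> 3 < b ->
  ham_circuit (hedge phi i u) (vedge phi k v).
Proof.
move=> tor m_gt0 b_gt3; wlog k0 : phi tor i u k v / k = 0.
  move=> W; have [psi [tors E]] := toroidal_place tor k 0.
  have [d [lt_d F]] := hedge_offset tor k i.
  have -> : hedge phi i u = hedge psi d u by rewrite F /hedge !E.
  have -> : vedge phi k v = vedge psi 0 v.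
    by rewrite /vedge -[k]addn0 E -addnS E.
  exact: W.
have [i' [u' [lt_i lt_u ->]]] := hedge_red tor m_gt0 b_gt3 i u; rewrite k0.
rewrite -(vedge_modn _ _ tor); have : v %% b < b by rewrite ltn_mod; lia.
move: (v %% b) => v' lt_v.
have [z [lt_z zu Ez]] : exists z, [/\ z < b, z != u' &
    vedge phi 0 v' = vedge phi 0 z \/ vedge phi 0 v' = vedge phi 0 z.+1].
  case: (eqVneq v' u') => [->|ne]; last by exists v'; split=> //; left.
  have [->|u0] := posnP u'.
    exists b.-1; split; try lia; right; rewrite prednK; last lia.
    by rewrite -[b]add0n (vedge_col tor).
  by exists u'.-1; split; try lia; right; rewrite prednK.
have [w [lt_w wz wu _]] := fresh3 z u' 0 b_gt3.
apply: (ham_stack tor) lt_z lt_w wz _ _ => //.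
  by constructor 1; exists i', u'; split=> //; lia.
by constructor 2; exists 0.
Qed.


Lemma ham_torus22 phi e f : toroidal 2 2 phi -> on_torus phi e -> on_torus phi f ->
  ham_circuit e f.
Proof.
move=> tor He Hf.
have [] := @square_circuit G (phi 0 0) (phi 0 1) (phi 1 1) (phi 1 0).
- by rewrite /= !inE !negb_or !andbT;
      repeat (apply/andP; split); apply/eqP=> /(tor_window tor)[]; lia.
- exact: (tor_adjh tor).
- exact: (tor_adjv tor).
- by rewrite adj_sym; apply: (tor_adjh tor).
- by rewrite adj_sym; apply: (tor_adjv tor).
move=> cJ /and4P[e1 e2 e3 e4].
have all_in d : on_torus phi d -> d \in cycle_edges [:: phi 0 0; phi 0 1; phi 1 1; phi 1 0].
  have r0 j : phi 2 j = phi 0 j := tor_row tor 0 j.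
  have c0 i : phi i 2 = phi i 0 := tor_col tor i 0.
  case=> i [j [->|->]].
    have [k [lt_k ->]] := hedge_offset tor 0 i; rewrite -(hedge_modn _ _ tor) add0n.
    have : j %% 2 < 2 by rewrite ltn_mod.
    case: (j %% 2) => [|[|//]] _; case: k lt_k => [|[|//]] _; rewrite /hedge ?c0 //.
    + by rewrite setUC.
    + by rewrite setUC.
  have [k [lt_k ->]] := vedge_offset tor 0 i; rewrite -(vedge_modn _ _ tor) add0n.
  have : j %% 2 < 2 by rewrite ltn_mod.
  case: (j %% 2) => [|[|//]] _; case: k lt_k => [|[|//]] _; rewrite /vedge ?r0 //.
  + by rewrite setUC.
  by rewrite setUC.
by exists [:: phi 0 0; phi 0 1; phi 1 1; phi 1 0]; split; rewrite ?(card_torus tor) ?all_in.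
Qed.

(** Two rungs of a prism may be far apart, so that a single cut does not help;
    the zigzag contains all rungs. *)
Lemma ham_prism b phi u v x y : toroidal 2 b phi -> ~~ odd b -> 2 < b ->
  ham_circuit (vedge phi x u) (vedge phi y v).
Proof.
move=> tor even_b b_gt2; have [J [cJ sJ _ eJ]] := tours_zigzag tor isT b_gt2 even_b.
have in_J k j : vedge phi k j \in cycle_edges J.
  have -> : vedge phi k j = vedge phi 0 j.
    have [d [lt_d ->]] := vedge_offset tor 0 k.
    case: d lt_d => [|[|//]] _ //.
    by rewrite /vedge setUC (tor_row tor 0).
  by rewrite -(vedge_modn _ _ tor); apply: eJ; exists (j %% b); rewrite ?ltn_mod //; lia.
by exists J; split; rewrite ?(card_torus tor) ?in_J // sJ; lia.
Qed.

(** By [ham_hh] and [ham_hv], once the longer direction is horizontal; two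
    vertical edges become horizontal after swapping the axes, unless there are
    only two rows. *)
Lemma ham_torus a b phi e f : ~~ odd a -> ~~ odd b -> 1 < a -> 1 < b ->
  toroidal a b phi -> on_torus phi e -> on_torus phi f -> ham_circuit e f.
Proof.
wlog le_ab : a b phi / a <= b.
  move=> W ea eb a1 b1 tor He Hf; case: (leqP a b) => [le|lt]; first exact: (W a b phi).
  have sw d : on_torus phi d -> on_torus (fun i j => phi j i) d.
    by case=> i [j [->|->]]; exists j, i; [right|left].
  by apply: (W b a _ _ _ _ _ _ (toroidal_swap tor)); auto; lia.
move=> ea eb a1 b1 tor He Hf.
have [m Em] : exists m, a = m.*2 by exists a./2; lia.
have [b2|b4] := leqP b 3.
  have Eb : b = 2 by lia.
  have Ea : a = 2 by lia.
  by subst a b; move: tor; rewrite Ea => tor; apply: ham_torus22 He Hf.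
subst a; have m0 : 0 < m by lia.
case: He Hf => i [u He] [k [v Hf]]; case: He Hf => -> [->|->].
- exact: (ham_hh tor).
- exact: (ham_hv _ _ _ _ tor).
- by apply: ham_circuitC; apply: (ham_hv _ _ _ _ tor).
have [m1|m2] := leqP m 1.
  have Em : m = 1 by lia.
  by move: tor; rewrite Em => tor; apply: (ham_prism _ _ _ _ tor) => //; lia.
have [n En] : exists n, b = n.*2 by exists b./2; lia.
have := toroidal_swap tor; rewrite En => torS.
by apply: (ham_hh torS); lia.
Qed.

(** A Hamiltonian circuit as a periodic map, of period 2 for K_2, the format in
    which two of them multiply to a torus. *)
Definition ham_param n (h : nat -> G) : Prop :=
  [/\ forall i, h (i + n) = h i, forall i, adj (h i) (h i.+1),
      forall x, exists2 i, i < n & x = h i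
    & forall i j, h i = h j -> i = j %[mod n]].

Lemma ham_param_of_circuit (J : seq G) : circuit J -> size J = #|G| ->
  exists h, ham_param #|G| h /\
    forall e, e \in cycle_edges J -> exists i, e = [set h i; h i.+1].
Proof.
case: J => [//|x0 J'] cJ; move EJ : (x0 :: J') cJ => J cJ sJ.
have uJ := circuit_uniq cJ; have J0 : 0 < size J by rewrite -EJ.
have ltm i : i %% size J < size J by rewrite ltn_mod.
pose h i := nth x0 J (i %% size J).
have hn i : h i.+1 = next J (h i).
  rewrite next_nth mem_nth // /h index_uniq // -EJ.
  rewrite -EJ /= in ltm *.
  have [E|ne] := eqVneq (i %% (size J').+1) (size J').
    by rewrite -addn1 -modnDml E addn1 modnn /= nth_default.
  rewrite -addn1 -modnDml addn1 modn_small //.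
  by have := ltm i; lia.
exists h; split.
  split; rewrite -?sJ.
  - by move=> i; rewrite /h modnDr.
  - move=> i; rewrite hn; apply: next_cycle; last exact: mem_nth.
    by case/and3P: cJ.
  - move=> x; have xJ : x \in J.
      have sub : {subset J <= enum G} by move=> y _; rewrite mem_enum.
      have le : size (enum G) <= size J by rewrite -cardE sJ.
      by rewrite (uniq_min_size uJ sub le).2 mem_enum.
    by exists (index x J); rewrite ?index_mem // /h modn_small ?index_mem // nth_index.
  by move=> i j /eqP; rewrite /h nth_uniq // => /eqP.
move=> e /cycle_edgesP[x xJ ->]; exists (index x J).
by rewrite hn /h modn_small ?index_mem // nth_index.
Qed.

End TwoEdges.

(** Even order is included because [ham_torus] needs even sides, and the
    existence of an edge because a projection may be a vertex. *)
Definition edge_pair_hamiltonian (A : sgraph) : Prop :=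
  [/\ ~~ odd #|A|, 1 < #|A|, exists e, e \in edges A
    & forall e f, e \in edges A -> f \in edges A -> exists h : nat -> A,
      [/\ ham_param #|A| h, exists i, e = [set h i; h i.+1]
        & exists i, f = [set h i; h i.+1]]].

Lemma edgesP (A : sgraph) (e : {set A}) :
  reflect (exists x y, adj x y /\ e = [set x; y]) (e \in edges A).
Proof.
apply: (iffP imsetP) => [[[x y]]|[x [y [xy ->]]]].
  by rewrite inE /= => xy ->; exists x, y.
by exists (x, y); rewrite ?inE.
Qed.

(** An edge of the product projects to an edge of one factor and a vertex of the
    other; for the latter an arbitrary edge [a0] or [b0] is prescribed. *)
Lemma product_torus (A B G : sgraph) (e f : {set G}) :
  edge_pair_hamiltonian A -> edge_pair_hamiltonian B ->
  isomorphic (cart_prod A B) G -> e \in edges G -> f \in edges G ->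
  exists phi : nat -> nat -> G,
    [/\ toroidal #|A| #|B| phi, on_torus phi e & on_torus phi f].
Proof.
move=> [_ _ [a0 a0E] hamA] [_ _ [b0 b0E] hamB] [p [q pK qK] p_adj] eE fE.
have proj d : d \in edges G -> exists dA dB, [/\ dA \in edges A, dB \in edges B
    & forall (hA : nat -> A) (hB : nat -> B), ham_param #|A| hA -> ham_param #|B| hB ->
      (exists i, dA = [set hA i; hA i.+1]) -> (exists i, dB = [set hB i; hB i.+1]) ->
      on_torus (fun i j => p (hA i, hB j)) d].
  case/edgesP=> x' [y' [xy ->]].
  rewrite -(qK x') -(qK y') p_adj in xy *.
  case: (q x') (q y') xy => [x1 x2] [y1 y2]; rewrite /= /cart_adj /=.
  case/orP=> /andP[/eqP<- xy].
    exists a0, [set x2; y2]; split=> //; first by apply/edgesP; exists x2, y2.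
    move=> hA hB [_ _ sA _] _ _ [j Ej]; have [i _ ->] := sA x1; exists i, j; left.
    by rewrite /hedge; case/set2_inj: Ej => -[-> ->] //; rewrite setUC.
  exists [set x1; y1], b0; split=> //; first by apply/edgesP; exists x1, y1.
  move=> hA hB _ [_ _ sB _] [i Ei] _; have [j _ ->] := sB x2; exists i, j; right.
  by rewrite /vedge; case/set2_inj: Ei => -[-> ->] //; rewrite setUC.
have [eA [eB [eAE eBE He]]] := proj e eE; have [fA [fB [fAE fBE Hf]]] := proj f fE.
have [hA [pA eiA fiA]] := hamA _ _ eAE fAE; have [hB [pB eiB fiB]] := hamB _ _ eBE fBE.
exists (fun i j => p (hA i, hB j)); split; [|exact: He|exact: Hf].
case: (pA) (pB) => cA aA sA iA [cB aB sB iB]; split.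
- by move=> i j; rewrite cA.
- by move=> i j; rewrite cB.
- by move=> i j; rewrite p_adj /= /cart_adj /= eqxx aA orbT.
- by move=> i j; rewrite p_adj /= /cart_adj /= eqxx aB.
- move=> x; have [i ? Ei] := sA (q x).1; have [j ? Ej] := sB (q x).2.
  by exists i, j; split=> //; rewrite -Ei -Ej -surjective_pairing qK.
by move=> i j i' j' /(can_inj pK)[/iA ? /iB ?].
Qed.

Lemma product_edge_pair_hamiltonian (A B : sgraph) :
  edge_pair_hamiltonian A -> edge_pair_hamiltonian B ->
  edge_pair_hamiltonian (cart_prod A B).
Proof.
move=> hA hB; have [eA A1 [a aE] _] := hA; have [eB B1 [b bE] _] := hB.
have cE : #|cart_prod A B| = #|A| * #|B| by rewrite card_prod.
split.
- by rewrite cE oddM negb_and eA.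
- by rewrite cE; nia.
- case/edgesP: aE => x [y [xy _]]; case/edgesP: bE => z [_ _].
  exists [set ((x, z) : cart_prod A B); (y, z)]; apply/edgesP; exists (x, z), (y, z).
  by rewrite /= /cart_adj /= eqxx xy orbT.
move=> e f eE fE.
have iso : isomorphic (cart_prod A B) (cart_prod A B) by exists id => //; exists id.
have [phi [tor te tf]] := product_torus hA hB iso eE fE.
have [J [cJ sJ eJ fJ]] := ham_torus eA eB A1 B1 tor te tf.
have [h [ph Eh]] := ham_param_of_circuit cJ sJ.
by exists h; split=> //; apply: Eh.
Qed.

(** * Factorizations of generalized hypercubes *)

(** The factors are chordless; for them this lists the neighbours of a vertex. *)
Definition traces (A : sgraph) (h : nat -> A) : Prop :=
  forall x y, adj x y -> exists i, [set x; y] = [set h i; h i.+1].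

Lemma traces_edges (A : sgraph) (h : nat -> A) (e : {set A}) :
  traces h -> e \in edges A -> exists i, e = [set h i; h i.+1].
Proof. by move=> H /edgesP[x [y [xy ->]]]; apply: H. Qed.

Lemma traces_neighbour (A : sgraph) n (h : nat -> A) i x : 0 < n ->
  ham_param n h -> traces h -> adj (h i.+1) x -> x = h i \/ x = h i.+2.
Proof.
move=> n_gt0 [hn _ _ h_inj] tr /tr[k E].
have h_mod k1 k2 : k1 = k2 %[mod n] -> h k1 = h k2.
  have red l : h l = h (l %% n).
    rewrite {1}(divn_eq l n) addnC; elim: (l %/ n) => [|d IH]; first by rewrite addn0.
    by rewrite mulSnr addnA hn.
  by move=> Ek; rewrite red Ek -red.
case/set2_inj: E => -[/h_inj Ei ->]; [right | left]; apply: h_mod.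
  by rewrite -addn1 -modnDml -Ei modnDml addn1.
by apply/eqP; rewrite -(eqn_modDr 1) !addn1; apply/eqP.
Qed.

Lemma complete2_traced : exists h : nat -> complete_graph 2, ham_param 2 h /\ traces h.
Proof.
pose h i : complete_graph 2 := Ordinal (ltn_pmod i (isT : 0 < 2)).
have hE i j : (h i == h j) = (i == j %[mod 2]) by [].
exists h; split; last first.
  case=> [[|[|//]] lx] [[|[|//]] ly] //= _; [exists 0 | exists 1];
    congr [set _; _]; exact: val_inj.
split.
- by move=> i; apply: val_inj; rewrite /= modnDr.
- by move=> i; rewrite /= /complete_adj hE; lia.
- by move=> x; exists x => //; apply: val_inj; rewrite /= modn_small.
by move=> i j /eqP; rewrite hE => /eqP.
Qed.

Lemma cycle_traced d : 2 < d -> exists h : nat -> cycle_graph d, ham_param d h /\ traces h.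
Proof.
move=> d_gt2; have d_gt0 : 0 < d by lia.
pose h i : cycle_graph d := Ordinal (ltn_pmod i d_gt0).
have hE i j : (h i == h j) = (i == j %[mod d]) by [].
exists h; split; last first.
  have hx (z : 'I_d) : z = h z by apply: val_inj; rewrite /= modn_small.
  move=> x y /andP[_] /orP[] /eqP E; [exists x | exists y; rewrite setUC];
    by congr [set _; _]; [exact: hx | apply: val_inj; rewrite /= E].
split.
- by move=> i; apply: val_inj; rewrite /= modnDr.
- move=> i; rewrite /= /cycle_adj hE /=; apply/andP; split.
    by apply/eqP=> /eq_mod_window; lia.
  by rewrite -addn1 modnDml addn1 eqxx.
- by move=> x; exists x => //; apply: val_inj; rewrite /= modn_small.
by move=> i j /eqP; rewrite hE => /eqP.
Qed.

Lemma traced_hamiltonian (A : sgraph) : ~~ odd #|A| -> 1 < #|A| ->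
  (exists h : nat -> A, ham_param #|A| h /\ traces h) -> edge_pair_hamiltonian A.
Proof.
move=> eA A1 [h [ph tr]]; split=> //.
  exists [set h 0; h 1]; apply/edgesP; exists (h 0), (h 1); split=> //.
  by case: ph.
by move=> e f eE fE; exists h; split=> //; apply: traces_edges.
Qed.

Definition even_dims (ds : seq nat) := all (fun d => (1 < d) && ~~ odd d) ds.

Lemma card_factor d : #|hypercube_factor d| = d.
Proof. by rewrite /hypercube_factor; case: eqP => [->|_]; rewrite card_ord. Qed.

Lemma factor_hamiltonian d : 1 < d -> ~~ odd d -> edge_pair_hamiltonian (hypercube_factor d).
Proof.
move=> d_gt1 even_d; apply: traced_hamiltonian; rewrite card_factor //.
rewrite /hypercube_factor; case: eqP => [->|d_ne2]; first exact: complete2_traced.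
by apply: cycle_traced; lia.
Qed.

Lemma card_gen_hypercube ds : #|gen_hypercube ds| = \prod_(d <- ds) d.
Proof.
elim: ds => [|d [|d' ds] IH]; rewrite ?big_nil ?card_ord // big_cons.
  by rewrite big_nil muln1 card_factor.
by rewrite -IH -[X in X * _]card_factor -card_prod.
Qed.

Lemma gen_hypercube_hamiltonian ds : ds != [::] -> even_dims ds ->
  edge_pair_hamiltonian (gen_hypercube ds).
Proof.
elim: ds => [//|d [|d' ds] IH] _ /= /andP[/andP[d1 ed] evs].
  exact: factor_hamiltonian.
apply: product_edge_pair_hamiltonian; first exact: factor_hamiltonian.
exact: IH.
Qed.

Lemma bipartite_prod A B : bipartite A -> bipartite B -> bipartite (cart_prod A B).
Proof.
case=> sA hA [sB hB]; exists (fun x => sA x.1 (+) sB x.2) => -[x1 x2] [y1 y2] /=.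
case/orP=> /= /andP[/eqP<-].
  by move=> /hB; case: (sA x1) (sB x2) (sB y2) => [] [] [].
by move=> /hA; case: (sB x2) (sA x1) (sA y1) => [] [] [].
Qed.

Lemma bipartite_factor d : 1 < d -> ~~ odd d -> bipartite (hypercube_factor d).
Proof.
rewrite /hypercube_factor => d1 ed; case: eqP => [_|d2].
  exists (fun x : 'I_2 => odd x) => -[[|[|//]] lx] [[|[|//]] ly] //.
exists (fun x : 'I_d => odd x) => x y /andP[_].
have step (u v : 'I_d) : u.+1 %% d == v -> odd u != odd v.
  move/eqP=> <-; have := ltn_ord u; rewrite leq_eqVlt => /orP[/eqP E|lt].
    by rewrite E modnn; lia.
  by rewrite modn_small //=; case: odd.
by case/orP=> /step //; rewrite eq_sym.
Qed.

Lemma bipartite_gen_hypercube ds : ds != [::] -> even_dims ds -> bipartite (gen_hypercube ds).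
Proof.
elim: ds => [//|d [|d' ds] IH] _ /= /andP[/andP[d1 ed] evs].
  exact: bipartite_factor.
by apply: bipartite_prod; [exact: bipartite_factor | exact: IH].
Qed.

Lemma iso_refl A : isomorphic A A.
Proof. by exists id => //; exists id. Qed.

Lemma iso_prodC A B : isomorphic (cart_prod A B) (cart_prod B A).
Proof.
exists (fun x : cart_prod A B => (x.2, x.1) : cart_prod B A).
  by exists (fun x => (x.2, x.1)) => -[].
by move=> [x1 x2] [y1 y2]; rewrite /= /cart_adj /= orbC.
Qed.

Lemma iso_prodA A B C :
  isomorphic (cart_prod (cart_prod A B) C) (cart_prod A (cart_prod B C)).
Proof.
exists (fun x : cart_prod (cart_prod A B) C => (x.1.1, (x.1.2, x.2)) : cart_prod A (cart_prod B C)).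
  by exists (fun x => ((x.1, x.2.1), x.2.2)) => [[[]]|[? []]].
move=> [[x y] z] [[x' y'] z']; rewrite /= /cart_adj /= /cart_adj /= !xpair_eqE.
by case: (x == x') (y == y') (z == z') (adj x x') (adj y y') (adj z z') => [] [] [] [] [] [].
Qed.

Lemma iso_prodAC A B C :
  isomorphic (cart_prod (cart_prod A C) B) (cart_prod A (cart_prod B C)).
Proof.
exists (fun x : cart_prod (cart_prod A C) B => (x.1.1, (x.2, x.1.2)) : cart_prod A (cart_prod B C)).
  by exists (fun x => ((x.1, x.2.2), x.2.1)) => [[[]]|[? []]].
move=> [[x y] z] [[x' y'] z']; rewrite /= /cart_adj /= /cart_adj /= !xpair_eqE.
by case: (x == x') (y == y') (z == z') (adj x x') (adj y y') (adj z z') => [] [] [] [] [] [].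
Qed.

(** If the first factor is a cycle, it is split off.  If it is K_2, it is joined
    with the second factor, or with a last factor K_2. *)
Lemma gen_hypercube_factorization ds : 1 < size ds -> even_dims ds ->
  8 <= #|gen_hypercube ds| ->
  (exists A B, [/\ edge_pair_hamiltonian A, edge_pair_hamiltonian B,
      isomorphic (cart_prod A B) (gen_hypercube ds)
      & 3 < #|A| /\ 3 < #|B| \/ #|A| = 2 /\ #|B| = 4])
  \/ exists2 p, 3 <= p & isomorphic (gen_hypercube ds)
                           (cart_prod (complete_graph 2) (cycle_graph (2 * p))).
Proof.
have exc d : 1 < d -> ~~ odd d -> d != 2 -> d != 4 -> exists2 p, 3 <= p &
    hypercube_factor d = cycle_graph (2 * p).
  by move=> d1 ed d2 d4; exists d./2; rewrite /hypercube_factor ?ifN //; [lia | congr cycle_graph; lia].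
have big R : R != [::] -> even_dims R -> R != [:: 2] -> 3 < #|gen_hypercube R|.
  case: R => [//|d [|d' R]] _ /=.
    by rewrite card_factor andbT eqseq_cons eqxx andbT; lia.
  case/andP=> dE /andP[d'E RE] _.
  have evR' : even_dims (d' :: R) by rewrite /= d'E.
  have [_ R1 _ _] := @gen_hypercube_hamiltonian (d' :: R) isT evR'.
  rewrite -/(gen_hypercube (d' :: R)) card_prod card_factor.
  have d1 : 1 < d by case/andP: dE.
  exact: leq_mul d1 R1.
case: ds => [//|d [//|d2 R]] _ /= /andP[/andP[d1 ed] /andP[/andP[d21 ed2] RE]] N8.
have hd := factor_hamiltonian d1 ed; have hd2 := factor_hamiltonian d21 ed2.
have evR : even_dims (d2 :: R) by rewrite /= d21 ed2.
have [Ed|d_ne2] := eqVneq d 2; last first.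
  have [ER|R_ne2] := eqVneq (d2 :: R) [:: 2]; last first.
    left; exists (hypercube_factor d), (gen_hypercube (d2 :: R)); split=> //.
    - exact: gen_hypercube_hamiltonian.
    - exact: iso_refl.
    by left; split; [rewrite card_factor; lia | apply: big].
  case: ER N8 => -> -> N8.
  have [E4|d_ne4] := eqVneq d 4.
    left; exists (hypercube_factor 2), (hypercube_factor 4); split.
    - exact: factor_hamiltonian.
    - exact: factor_hamiltonian.
    - by rewrite E4; apply: iso_prodC.
    by right; rewrite !card_factor.
  have [p p3 ->] := exc d d1 ed d_ne2 d_ne4.
  by right; exists p => //; apply: iso_prodC.
subst d; case: R RE evR N8 => [|d3 R] RE evR N8.
  have [E2|ne2] := eqVneq d2 2.
    by move: N8; rewrite card_prod !card_factor E2.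
  have [E4|ne4] := eqVneq d2 4.
    left; exists (hypercube_factor 2), (hypercube_factor d2); split=> //.
      exact: iso_refl.
    by right; rewrite !card_factor.
  have [p p3 E] := exc d2 d21 ed2 ne2 ne4.
  by right; exists p => //; rewrite /= E; apply: iso_refl.
have [ER|R_ne2] := eqVneq (d3 :: R) [:: 2]; last first.
  left; exists (cart_prod (hypercube_factor 2) (hypercube_factor d2)), (gen_hypercube (d3 :: R)).
  split.
  - exact: product_edge_pair_hamiltonian.
  - exact: gen_hypercube_hamiltonian.
  - exact: iso_prodA.
  by left; split; [rewrite card_prod !card_factor; lia | apply: big].
case: ER evR N8 => -> -> evR N8.
have [E2|ne2] := eqVneq d2 2.
  left; exists (hypercube_factor 2), (gen_hypercube [:: d2; 2]); split=> //.
  - exact: gen_hypercube_hamiltonian.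
  - exact: iso_refl.
  by right; rewrite !card_gen_hypercube !card_factor E2 !big_cons big_nil.
left; exists (cart_prod (hypercube_factor 2) (hypercube_factor 2)), (hypercube_factor d2).
split=> //.
- exact: product_edge_pair_hamiltonian.
- exact: iso_prodAC.
by left; rewrite card_prod !card_factor; lia.
Qed.

(** * The characterization *)

Lemma two_dcc_of_splits (G : sgraph) (e f : {set G}) l : 2 < l -> l.+2 < #|G| ->
  splits e f l -> exists J1 J2 : seq G,
    [/\ two_dcc J1 J2, cycle_length J1 = l, cycle_length J2 = #|G| - l,
        e \in cycle_edges J1 & f \in cycle_edges J2].
Proof.
move=> l_gt2 lt_l [J1 [J2 [/andP[c1 c2] [s1 s2] dis e1 f2]]].
have i1 : is_cycle J1 by apply: circuit_is_cycle => //; lia.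
have i2 : is_cycle J2 by apply: circuit_is_cycle => //; lia.
exists J1, J2; split; rewrite ?cycle_lengthE //; split=> //.
  by apply/setP=> x; rewrite !inE; apply/negP=> /andP[/dis/negP].
have uJ : uniq (J1 ++ J2).
  rewrite cat_uniq !circuit_uniq // andbT; apply/hasPn=> x x2.
  by apply: contraL x2 => /dis.
apply/eqP; rewrite eqEcard subsetT cardsT.
have -> : #|cycle_vertices J1 :|: cycle_vertices J2| = #|J1 ++ J2|.
  by apply: eq_card => x; rewrite !inE mem_cat.
by rewrite (card_uniqP uJ) size_cat; lia.
Qed.

(** The successor map of a cycle is transitive on its vertices. *)
Lemma next_invariant (G : sgraph) (J : seq G) (P : G -> Prop) v : uniq J -> v \in J -> P v ->
  (forall x, x \in J -> P x -> P (next J x)) -> forall x, x \in J -> P x.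
Proof.
move=> uJ vJ Pv step; have [i s Ei] := rot_to vJ.
have fc : fcycle (next J) (v :: s).
  by rewrite -Ei; have := cycle_next uJ; rewrite -(rot_cycle i).
have sub : {subset v :: s <= J} by move=> x; rewrite -Ei mem_rot.
suff H : forall p u, P u -> u \in J -> fpath (next J) u p -> forall x, x \in p -> P x.
  move=> x; rewrite -(mem_rot i) Ei inE => /predU1P[->//|xs].
  move: fc; rewrite /= rcons_path => /andP[ps _]; exact: H ps _ xs.
elim=> [//|y p IH] u Pu uJ' /= /andP[/eqP Ey pp] x.
have Py : P y by rewrite -Ey; apply: step.
have yJ : y \in J by rewrite -Ey mem_next.
by rewrite inE => /predU1P[->//|]; apply: IH pp x.
Qed.

Lemma next_of_two_edges (G : sgraph) (J : seq G) v w w' : uniq J -> v \in J ->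
  [set v; w] \in cycle_edges J -> [set v; w'] \in cycle_edges J -> w != w' ->
  next J v = w \/ next J v = w'.
Proof.
move=> uJ vJ /cycle_edgesP[x xJ /set2_inj[[-> ->]|[Ev Ew]]]; first by left.
case/cycle_edgesP=> y yJ /set2_inj[[-> ->]|[Ev' Ew']]; first by right.
by rewrite Ew Ew' -(prev_next uJ x) -(prev_next uJ y) -Ev -Ev' eqxx.
Qed.

Lemma edges_of_two_neighbours (G : sgraph) (J : seq G) v w w' :
  is_cycle J -> v \in J -> (forall x, x \in J -> adj v x -> x = w \/ x = w') ->
  ([set v; w] \in cycle_edges J) && ([set v; w'] \in cycle_edges J).
Proof.
case/and3P=> sJ uJ cJ vJ nb.
have nE : [set v; next J v] \in cycle_edges J by apply/cycle_edgesP; exists v.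
have pE : [set v; prev J v] \in cycle_edges J.
  by apply/cycle_edgesP; exists (prev J v); rewrite ?mem_prev // next_prev // setUC.
have ne : next J v != prev J v.
  apply/eqP=> E; have := next_next_neq uJ sJ vJ.
  by rewrite E next_prev // eqxx.
have nn : next J v = w \/ next J v = w'.
  by apply: nb; [rewrite mem_next | apply: next_cycle cJ vJ].
have pp : prev J v = w \/ prev J v = w'.
  by apply: nb; [rewrite mem_prev | rewrite adj_sym; apply: prev_cycle cJ vJ].
by case: nn pp => En [] Ep; move: ne nE pE; rewrite En Ep ?eqxx // => _ -> ->.
Qed.

(** The first cycle has to be the square over columns 1 and 2.  In the second one
    both vertices of column 3 are left with two neighbours each, so their edges
    are forced; together with the rung in column 4 they close up to a square,
    which misses column 5. *)
Lemma prism_no_dcc (G : sgraph) n (phi : nat -> nat -> G) (J1 J2 : seq G) :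
  toroidal 2 n phi -> 5 < n ->
  (forall i j x, adj (phi i j.+1) x -> [\/ x = phi i.+1 j.+1, x = phi i j.+2 | x = phi i j]) ->
  is_cycle J1 -> is_cycle J2 -> size J1 = 4 ->
  (forall x, (x \in J2) = (x \notin J1)) ->
  hedge phi 0 1 \in cycle_edges J1 -> vedge phi 0 4 \in cycle_edges J2 -> False.
Proof.
move=> tor n5 nbr cyc1 cyc2 s1 J2E e1 f2.
have neq i j i' j' : i < 2 -> i' < 2 -> j < 6 -> j' < 6 -> phi i j = phi i' j' -> i = i' /\ j = j'.
  by move=> ? ? ? ? /(tor_window tor)[]; lia.
have per j : phi 2 j = phi 0 j := tor_row tor 0 j.
have circ1 : circuit J1.
  by case/and3P: cyc1 => sJ uJ cJ; apply/and3P; split=> //; lia.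
have [mem1 col2] : (forall x, x \in J1 -> exists i j, [/\ i < 2, 0 < j < 3 & x = phi i j])
    /\ (forall i, i < 2 -> phi i 2 \in J1).
  have [s [cs ps _]] := open_circuit circ1 e1.
  move: (perm_size ps); rewrite /= size_rcons s1 => -[].
  case: s cs ps => [|z [|t [|//]]] //= cs ps _.
  have /and5P[xz zt ty yx _] : [&& adj (phi 0 1) z, adj z t, adj t (phi 0 2), adj (phi 0 2) (phi 0 1) & true].
    by case/and3P: cs.
  have uz := circuit_uniq cs.
  have nz : z != phi 0 2.
    by apply: contraTneq uz => ->; rewrite /= !inE eqxx ?orbT ?andbF.
  have nt : t != phi 0 1.
    by apply: contraTneq uz => ->; rewrite /= !inE eqxx ?orbT ?andbF.
  rewrite adj_sym in ty.
  have Et : t = phi 1 2 \/ t = phi 0 3.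
    by case: (nbr 0 1 t ty) => Et; [left|right|case/eqP: nt].
  have Ez : z = phi 1 1 \/ z = phi 0 0.
    by case: (nbr 0 0 z xz) => Ez; [left|case/eqP: nz|right].
  have [Et' Ez'] : t = phi 1 2 /\ z = phi 1 1.
    case: Et zt => -> zt.
      split=> //; case: Ez zt => -> //; rewrite adj_sym => /(nbr 1 1)[];
      by rewrite ?per => /neq[].
    by case: Ez zt => ->; rewrite adj_sym => /(nbr 0 2)[] /neq[].
  split=> [x|[|[|//]] _]; rewrite -(perm_mem ps) !inE Et' Ez' ?eqxx ?orbT //.
  case/or4P=> /eqP ->; [exists 0, 1|exists 1, 1|exists 1, 2|exists 0, 2]; split=> //.
have in2 i j : i < 2 -> 2 < j < 6 -> phi i j \in J2.
  move=> lt_i lt_j; rewrite J2E; apply/negP=> /mem1[i' [j' [lt_i' lt_j']]].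
  by case/neq; lia.
have out2 i : i < 2 -> phi i 2 \notin J2 by move=> lt_i; rewrite J2E negbK col2.
have uJ2 : uniq J2 by case/and3P: cyc2.
have /andP[h0 v0] : (hedge phi 0 3 \in cycle_edges J2) && (vedge phi 0 3 \in cycle_edges J2).
  apply: edges_of_two_neighbours; rewrite ?in2 // => x xJ /nbr[] Ex; auto.
  by case/negP: (out2 0 isT); rewrite -Ex.
have /andP[h1 v1] : (hedge phi 1 3 \in cycle_edges J2) && (vedge phi 1 3 \in cycle_edges J2).
  apply: edges_of_two_neighbours; rewrite ?in2 // => x xJ /nbr[] Ex; auto.
  by case/negP: (out2 1 isT); rewrite -Ex.
have ne i j i' j' : i < 2 -> i' < 2 -> j < 6 -> j' < 6 -> (i != i') || (j != j') ->
    phi i j != phi i' j'.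
  by move=> ? ? ? ? d; apply/eqP=> /neq[] // Ei Ej; move: d; rewrite Ei Ej !eqxx.
have [m03 m04] := (in2 0 3 isT isT, in2 0 4 isT isT).
have [m13 m14] := (in2 1 3 isT isT, in2 1 4 isT isT).
pose P x := [\/ x = phi 0 3, x = phi 0 4, x = phi 1 4 | x = phi 1 3].
have step x : x \in J2 -> P x -> P (next J2 x).
  move=> xJ [] ->.
  - by have [->|->] := next_of_two_edges uJ2 m03 h0 v0 (ne 0 4 1 3 isT isT isT isT isT);
      [constructor 2 | constructor 4].
  - rewrite /hedge setUC in h0.
    by have [->|->] := next_of_two_edges uJ2 m04 h0 f2 (ne 0 3 1 4 isT isT isT isT isT);
      [constructor 1 | constructor 3].
  - rewrite /vedge setUC in f2; rewrite /hedge setUC in h1.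
    by have [->|->] := next_of_two_edges uJ2 m14 f2 h1 (ne 0 4 1 3 isT isT isT isT isT);
      [constructor 2 | constructor 4].
  rewrite /vedge setUC in v0.
  by have [->|->] := next_of_two_edges uJ2 m13 h1 v0 (ne 1 4 0 3 isT isT isT isT isT);
    [constructor 3 | constructor 1].
have P03 : P (phi 0 3) by constructor 1.
have := next_invariant uJ2 m03 P03 step (in2 0 5 isT isT).
by case=> /neq[].
Qed.

Lemma prism_not_bipancyclic (G : sgraph) p : 3 <= p ->
  isomorphic G (cart_prod (complete_graph 2) (cycle_graph (2 * p))) ->
  ~ two_dcc_edge_bipancyclic G 4 #|G|./2.
Proof.
move=> p_ge3 [f [g fK gK] f_adj] [_ _ _ main].
have g_adj x y : adj (g x) (g y) = adj x y by rewrite -f_adj !gK.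
have [|hB [pB tB]] := @cycle_traced (2 * p); first by lia.
have [hA [pA tA]] := complete2_traced.
have p2 : 0 < 2 * p by lia.
pose phi i j := g (hA i, hB j).
have [cA aA sA iA] := pA; have [cB aB sB iB] := pB.
have tor : toroidal 2 (2 * p) phi.
  split.
  - by move=> i j; rewrite /phi cA.
  - by move=> i j; rewrite /phi cB.
  - by move=> i j; rewrite g_adj; apply/orP; right; rewrite eqxx; apply: aA.
  - by move=> i j; rewrite g_adj; apply/orP; left; rewrite eqxx; apply: aB.
  - move=> x; have [i ? Ei] := sA (f x).1; have [j ? Ej] := sB (f x).2.
    by exists i, j; split=> //; rewrite /phi -Ei -Ej -surjective_pairing fK.
  by move=> i j i' j' /(can_inj gK)[/iA ? /iB ?].
have nbr i j x : adj (phi i j.+1) x ->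
    [\/ x = phi i.+1 j.+1, x = phi i j.+2 | x = phi i j].
  rewrite -(fK x) g_adj; case: (f x) => y z; rewrite /= /cart_adj /=.
  case/orP=> /andP[/eqP<-].
    by case/(traces_neighbour p2 pB tB) => ->; [constructor 3 | constructor 2].
  (* Both neighbours of [hA (i + 2)] along the closed walk are [hA (i + 1)]. *)
  rewrite -(cA i) addn2 => /(traces_neighbour (isT : 0 < 2) pA tA) E.
  constructor 1; case: E => -> //.
  by rewrite /phi -[in RHS](cA i.+1) addn2.
have N := card_torus tor.
have eE : hedge phi 0 1 \in edges G.
  by apply/edgesP; exists (phi 0 1), (phi 0 2); split=> //; apply: (tor_adjh tor).
have fE : vedge phi 0 4 \in edges G.
  by apply/edgesP; exists (phi 0 4), (phi 1 4); split=> //; apply: (tor_adjv tor).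
have dis : independent (hedge phi 0 1) (vedge phi 0 4).
  apply/pred0P=> x /=; apply/negP; rewrite !inE => /andP[/orP[] /eqP-> /orP[] /eqP/(tor_window tor)[]];
  lia.
have [||J1 [J2 [[cJ1 cJ2 dJ cov] l1 _ e1 f2]]] := main _ _ eE fE dis 4; rewrite ?N //; first by lia.
apply: (prism_no_dcc tor _ nbr cJ1 cJ2 _ _ e1 f2); first by lia.
  by rewrite -cycle_lengthE.
move=> x; have := in_setT x; rewrite -cov; have := in_set0 x; rewrite -dJ !inE.
by case: (x \in J1) (x \in J2) => [] [].
Qed.

Lemma gen_hypercube_bipancyclic ds : 1 < size ds -> even_dims ds ->
  8 <= #|gen_hypercube ds| ->
  (forall p, 3 <= p -> ~ isomorphic (gen_hypercube ds)
     (cart_prod (complete_graph 2) (cycle_graph (2 * p)))) ->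
  two_dcc_edge_bipancyclic (gen_hypercube ds) 4 #|gen_hypercube ds|./2.
Proof.
move=> s2 ev N8 not_prism.
have ds0 : ds != [::] by case: ds s2 {ev N8 not_prism}.
split; [exact: bipartite_gen_hypercube | lia | lia |].
move=> e f eE fE dis l even_l /andP[l4 le_l].
apply: two_dcc_of_splits; try lia.
case: (gen_hypercube_factorization s2 ev N8) => [[A [B [hA hB iso cAB]]]|[p p3 /not_prism[]//]].
have [phi [tor te tf]] := product_torus hA hB iso eE fE.
have [ea _ _ _] := hA; have [eb _ _ _] := hB.
case: cAB => [[A4 B4]|[A2 B4]].
  have El : l = l./2.*2 by lia.
  by rewrite El; apply: (splits_torus _ _ _ _ tor te tf dis); rewrite /even4 ?ea ?eb //; lia.
rewrite A2 B4 in tor; have N := card_torus tor.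
have -> : l = 4 by lia.
exact: (splits_cube tor te tf dis).
Qed.

Lemma gen_hypercube_small ds : 1 < size ds -> even_dims ds ->
  #|gen_hypercube ds| < 8 -> ds = [:: 2; 2].
Proof.
case: ds => [//|d1 [//|d2 ds]] _; rewrite card_gen_hypercube !big_cons.
case/andP=> /andP[d1_gt1 ed1] /andP[/andP[d2_gt1 ed2] ev].
case: ds ev => [_|d3 ds ev].
  rewrite big_nil muln1 => lt8; congr [:: _; _]; nia.
have : 1 < \prod_(d <- d3 :: ds) d.
  have [_ + _ _] := @gen_hypercube_hamiltonian (d3 :: ds) isT ev.
  by rewrite card_gen_hypercube.
by move: (\prod_(d <- _) d) => X X1; have := leq_mul d1_gt1 (leq_mul d2_gt1 X1); lia.
Qed.

Lemma no_two_dcc_below_six (G : sgraph) : #|G| < 6 ->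
  ~ exists J1 J2 : seq G, two_dcc J1 J2.
Proof.
move=> N [J1 [J2 [/and3P[s1 u1 _] /and3P[s2 u2 _] dis _]]].
have uJ : uniq (J1 ++ J2).
  rewrite cat_uniq u1 u2 andbT; apply/hasPn=> x x2; apply/negP=> x1.
  by have := in_set0 x; rewrite -dis !inE x1 x2.
by have := max_card [in J1 ++ J2]; rewrite (card_uniqP uJ) size_cat; lia.
Qed.

Lemma square_is_cycle4 : isomorphic (gen_hypercube [:: 2; 2]) (cycle_graph 4).
Proof.
pose around (i j : 'I_2) : nat := if i == 0 :> nat then j : nat else 3 - j.
have lt_around i j : around i j < 4.
  by rewrite /around; have := ltn_ord j; case: ifP; lia.
pose f (x : gen_hypercube [:: 2; 2]) : cycle_graph 4 := Ordinal (lt_around x.1 x.2).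
exists f.
  apply: inj_card_bij; last by rewrite card_gen_hypercube card_ord !big_cons big_nil.
  by case=> [[[|[|//]] l1] [[|[|//]] l2]] [[[|[|//]] l3] [[|[|//]] l4]] // _;
    congr (_, _); apply: val_inj.
by case=> [[[|[|//]] l1] [[|[|//]] l2]] [[[|[|//]] l3] [[|[|//]] l4]].
Qed.

Theorem theorem3p2 :
  (forall (n : nat) (d : n.-tuple nat),
     2 <= n ->
     (forall i : 'I_n, 2 <= tnth d i) ->
     (forall i : 'I_n, ~~ odd (tnth d i)) ->
     (8 <= #|gen_hypercube d| ->
        (two_dcc_edge_bipancyclic (gen_hypercube d) 4 #|gen_hypercube d|./2 <->
         forall p : nat, 3 <= p ->
           ~ isomorphic (gen_hypercube d)
                        (cart_prod (complete_graph 2) (cycle_graph (2 * p)))))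
     /\ (#|gen_hypercube d| < 8 -> tval d = [:: 2; 2]))
  /\ [/\ #|gen_hypercube [:: 2; 2]| = 4,
         isomorphic (gen_hypercube [:: 2; 2]) (cycle_graph 4)
       & ~ exists J1 J2 : seq (gen_hypercube [:: 2; 2]), two_dcc J1 J2].
Proof.
have c22 : #|gen_hypercube [:: 2; 2]| = 4 by rewrite card_gen_hypercube !big_cons big_nil.
split; last first.
  split=> //; first exact: square_is_cycle4.
  by apply: no_two_dcc_below_six; rewrite c22.
move=> n d n_ge2 d_ge2 d_even.
have s2 : 1 < size d by rewrite size_tuple.
have ev : even_dims d.
  by apply/allP=> _ /tnthP[i ->]; rewrite d_ge2 d_even.
split=> [N8|]; last exact: gen_hypercube_small.
split=> [bip p p3 /prism_not_bipancyclic|]; first exact.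
exact: gen_hypercube_bipancyclic.
Qed.
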